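(* Let $q>1$ be any real number. If $m\geq 2$ is an even integer, then $$\int_{0}^{1}\frac{\left(x^{q-2}+1\right)\log\left(x^{mq}+1\right)}{x^q+1}\,dx=\frac{m}{4q}\left(\psi'\left(\frac{2q-1}{2q}\right)-\psi'\left(\frac{q-1}{2q}\right)\right)-\frac{1}{q}\sum_{k=0}^{\frac{m}{2}-1}\sum_{p=1}^{\infty}\frac{2^p(\varphi_k+1)^p}{p}\,\frac{\Gamma\left(p+\frac{1}{q}\right)\Gamma\left(p+1-\frac{1}{q}\right)}{(2p)!}-\frac{m\pi}{q\sin\frac{\pi}{q}}\left(\psi\left(1-\frac{1}{q}\right)-\psi(1)\right).$$ If $m\geq 1$ is an odd integer, then $$\int_{0}^{1}\frac{\left(x^{q-2}+1\right)\log\left(x^{mq}+1\right)}{x^q+1}\,dx=\frac{m}{4q}\left(\psi'\left(\frac{2q-1}{2q}\right)-\psi'\left(\frac{q-1}{2q}\right)\right)-\frac{1}{q}\sum_{k=0}^{\frac{m-3}{2}}\sum_{p=1}^{\infty}\frac{2^p(\varphi_k+1)^p}{p}\,\frac{\Gamma\left(p+\frac{1}{q}\right)\Gamma\left(p+1-\frac{1}{q}\right)}{(2p)!}-\frac{m\pi}{q\sin\frac{\pi}{q}}\left(\psi\left(1-\frac{1}{q}\right)-\psi(1)\right).$$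
   Context: $\Gamma$ is the gamma function, $\psi(x)=\Gamma'(x)/\Gamma(x)$ ($x>0$) is the digamma function, and $\psi'$ is its derivative. For given $m$, $\varphi_k=\cos\left(\frac{(2k+1)\pi}{m}\right)$. An empty sum $\sum_{k=0}^{-1}(\cdot)$ is taken to be zero. *)

(* Defs.v *)
From mathcomp Require Import all_boot all_order all_algebra.
From mathcomp Require Import all_classical all_reals all_analysis.

Set Implicit Arguments.
Unset Strict Implicit.
Unset Printing Implicit Defensive.

Import Order.TTheory GRing.Theory Num.Theory.
Import numFieldNormedType.Exports.

Local Open Scope classical_set_scope.
Local Open Scope ring_scope.

(* Meaningful for 0 < s only; where the integral diverges, Rintegral (and hence
   Gamma) is 0 by convention. *)
Definition Gamma {R : realType} (s : R) : R :=
  \int[lebesgue_measure]_(t in `]0, +oo[) (t `^ (s - 1) * expR (- t)).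

Definition digamma {R : realType} (x : R) : R := derive1 Gamma x / Gamma x.

Definition trigamma {R : realType} (x : R) : R := derive1 digamma x.

Definition varphi {R : realType} (m k : nat) : R :=
  cos ((2 * k + 1)%:R * pi / m%:R).

Definition integrand {R : realType} (q : R) (m : nat) (x : R) : R :=
  (x `^ (q - 2) + 1) * ln (x `^ (m%:R * q) + 1) / (x `^ q + 1).

Definition inner_term {R : realType} (q : R) (m k p : nat) : R :=
  2 ^+ p * (varphi m k + 1) ^+ p / p%:R
  * (Gamma (p%:R + q^-1) * Gamma (p%:R + 1 - q^-1) / ((2 * p)`!)%:R).

Definition inner_partial_sum {R : realType} (q : R) (m k : nat) : R^nat :=
  fun n => \sum_(1 <= p < n.+1) inner_term q m k p.

(* N is the number of values of k: k = 0, ..., N - 1. *)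
Definition closed_form {R : realType} (q : R) (m N : nat) : R :=
  m%:R / (4 * q)
    * (trigamma ((2 * q - 1) / (2 * q)) - trigamma ((q - 1) / (2 * q)))
  - q^-1 * (\sum_(0 <= k < N) limn (inner_partial_sum q m k))
  - m%:R * pi / (q * sin (pi / q)) * (digamma (1 - q^-1) - digamma 1).

(* Main.v *)
Require Import Defs.
From mathcomp Require Import all_boot all_order all_algebra.
From mathcomp Require Import all_classical all_reals all_analysis.
From mathcomp Require Import measurable_realfun ring lra zify.
Import Order.TTheory GRing.Theory Num.Theory.
Import numFieldNormedType.Exports.
Local Open Scope classical_set_scope.
Local Open Scope ring_scope.

(** Let a = 1/q. The substitution x = exp(t/q) turns the integral over [0, 1]
    into one over the half-line t <= 0, and folding the real line at 0 gives

      q I + m M = K,  K = \int_R e^{at} log(1 + e^{mt}) / (1 + e^t) dt,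
                      M = \int_{t >= 0} t e^{-(1-a)t} / (1 + e^{-t}) dt.

    Expanding the denominator of M in a geometric series yields the trigamma
    difference. Since 1 + u^m = (1 + u)^m \prod_k (1 - c_k u / (1 + u)^2) with
    c_k = 2 (\varphi_k + 1) and 0 < c_k u / (1 + u)^2 < 1, the logarithm series
    and Euler's beta integral express K as m times the integral of
    e^{at} log(1 + e^t) / (1 + e^t), minus the Gamma series. That last integral
    is minus the derivative at c = 1 of
    \int_R e^{at} (1 + e^t)^{-c} dt = \Gamma(a) \Gamma(c - a) / \Gamma(c),
    which gives the digamma term through the reflection formula.

    The derivatives of \Gamma and \psi only need \Gamma(s+1) = s \Gamma(s) and
    \Gamma(s+h) <= s^h \Gamma(s) for 0 <= h <= 1. The reflection formula
    compares \Gamma(n+1+a) \Gamma(n+1-a) / n!^2 with the ratio of the integrals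
    of cos(2ax) cos(x)^{2n} and cos(x)^{2n} over [0, pi/2]: their product does not
    depend on n, and both tend to 1.

    All integrands are nonnegative, so that every interchange is an instance of
    Tonelli's theorem or of monotone convergence, and finiteness comes last. *)

Set Implicit Arguments.
Unset Strict Implicit.
Unset Printing Implicit Defensive.

(** * Change of variables *)

Section change_of_variables.
Context {R : realType}.
Local Notation mu := (@lebesgue_measure R).

(** Monotone convergence along growing segments, which carries calculus on compact intervals over to
    unbounded or half-open domains. *)
Lemma ge0_integral_exhaust (f : R -> \bar R) (a b : R^nat) (D : set R) :
  {homo a : m n / (m <= n)%N >-> n <= m} ->
  {homo b : m n / (m <= n)%N >-> m <= n} ->
  D = \bigcup_n `[a n, b n]%classic -> measurable_fun D f ->
  (forall x, D x -> 0 <= f x)%E ->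
  (\int[mu]_(x in `[a n, b n]) f x)%E @[n --> \oo]
    --> (\int[mu]_(x in D) f x)%E.
Proof.
move=> ha hb DE mf f0; rewrite DE.
have sD n : `[a n, b n]%classic `<=` D by rewrite DE => x abx; exists n.
apply: ge0_nondecreasing_set_cvg_integral => //.
- apply/nondecreasing_seqP => n; rewrite subsetEset.
  by apply: subset_itv; rewrite bnd_simp; [exact: ha|exact: hb].
- by move=> n; apply: measurable_funS mf => //; rewrite DE; exact: bigcup_measurable.
- by move=> n x /sD; exact: f0.
Qed.

(** An increasing [F] maps the segments exhausting [A] onto those exhausting [B]. The two integrals
    agree on each such pair by the substitution rule on compact intervals, and both sequences
    converge in [\bar R], possibly to infinity. *)
Lemma ge0_integral_substitution (F G : R -> R) (a b : R^nat) (A B : set R) :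
  (forall n, a n <= b n) ->
  {homo a : m n / (m <= n)%N >-> n <= m} ->
  {homo b : m n / (m <= n)%N >-> m <= n} ->
  {homo F : x y / x < y} ->
  (forall x, derivable F x 1) -> continuous (derive1 F) ->
  A = \bigcup_n `[a n, b n]%classic -> B = \bigcup_n `[F (a n), F (b n)]%classic ->
  {in B, continuous G} -> (forall x, B x -> 0 <= G x) ->
  (\int[mu]_(x in B) (G x)%:E = \int[mu]_(x in A) (G (F x) * derive1 F x)%:E)%E.
Proof.
move=> ab ha hb iF dF cF' AE BE cG G0.
have iF' : {homo F : x y / x <= y} by exact: ltW_homo.
have cF : continuous F.
  by move=> x; apply: differentiable_continuous; exact/derivable1_diffP.
have sA n x : `[a n, b n]%classic x -> B (F x).
  rewrite /= in_itv/= => /andP[ax xb]; rewrite BE; exists n => //=.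
  by rewrite in_itv/= !iF'.
have sA' x : A x -> B (F x) by rewrite AE => -[n _]; exact: sA.
have F'0 x : 0 <= derive1 F x.
  apply: (@incr_derive1_ge0 _ _ setT) => //.
  - by move=> y z _ _; exact: iF.
  - by rewrite interiorT.
have mA : measurable A by rewrite AE; exact: bigcup_measurable.
have mB : measurable B by rewrite BE; exact: bigcup_measurable.
have mG : measurable_fun B G.
  apply: subspace_continuous_measurable_fun => //.
  exact: continuous_in_subspaceT.
have mGF : measurable_fun A (fun x => G (F x) * derive1 F x).
  apply: subspace_continuous_measurable_fun => //.
  apply: continuous_in_subspaceT => x; rewrite inE => /sA' Bx.
  apply: continuousM; last exact: cF'.
  by apply: continuous_comp; [exact: cF|apply: cG; rewrite inE].
have h1 : (\int[mu]_(x in `[F (a n), F (b n)]) (G x)%:E)%E @[n --> \oo] -->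
    (\int[mu]_(x in B) (G x)%:E)%E.
  apply: (@ge0_integral_exhaust _ (F \o a) (F \o b)) => //.
  - by move=> m n mn; apply: iF'; exact: ha.
  - by move=> m n mn; apply: iF'; exact: hb.
  - exact/measurable_EFinP.
have h2 : (\int[mu]_(x in `[a n, b n]) (G (F x) * derive1 F x)%:E)%E @[n --> \oo] -->
    (\int[mu]_(x in A) (G (F x) * derive1 F x)%:E)%E.
  apply: ge0_integral_exhaust => //.
  - exact/measurable_EFinP.
  - by move=> x /sA' Bx; rewrite lee_fin mulr_ge0// G0.
suff E : (fun n => \int[mu]_(x in `[F (a n), F (b n)]) (G x)%:E)%E =
    (fun n => \int[mu]_(x in `[a n, b n]) (G (F x) * derive1 F x)%:E)%E.
  by rewrite E in h1; exact: (cvg_unique _ h1 h2).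
apply/funext => n.
rewrite (integration_by_substitution_increasing (ab n))//.
- by move=> x y _ _; exact: iF.
- by apply/cvg_ex; eexists; apply: cvg_at_right_filter; exact: cF'.
- by apply/cvg_ex; eexists; apply: cvg_at_left_filter; exact: cF'.
- split => //.
  + by apply: cvg_at_right_filter; exact: cF.
  + by apply: cvg_at_left_filter; exact: cF.
- apply: continuous_in_subspaceT => x; rewrite inE => xab.
  by apply: cG; rewrite inE BE; exists n.
Qed.

Lemma bigcup_symitv : \bigcup_n `[- n%:R, n%:R : R]%classic = [set: R].
Proof.
apply/seteqP; split => // x _; exists (Num.bound `|x|) => //=.
by rewrite in_itv/= -ler_norml ltW// archi_boundP.
Qed.

Lemma bigcup_symitv0 : \bigcup_n `[- n%:R, 0]%classic = `]-oo, 0 : R]%classic.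
Proof.
apply/seteqP; split => [x [n _] /=|x /=]; rewrite !in_itv/=; first by case/andP.
move=> x0; exists (Num.bound `|x|) => //=.
by rewrite in_itv/= x0 andbT lerNl -(ler0_norm x0) ltW// archi_boundP.
Qed.

Let is_derive_expRM c (x : R) :
  is_derive x 1 (fun y => expR (c * y)) (expR (c * x) * c).
Proof. by apply: is_derive_eq; rewrite /GRing.scale/= mulr1 mulrC. Qed.

Let derive1_expRM c :
  derive1 (fun y : R => expR (c * y)) = fun x => expR (c * x) * c.
Proof.
by apply/funext => x; rewrite derive1E; have [_ ->] := is_derive_expRM c x.
Qed.

Let cont_expRM c : continuous (fun x : R => expR (c * x) * c).
Proof.
move=> x; apply: cvgM; last exact: cvg_cst.
apply: (@continuous_comp _ _ _ (fun y => c * y) expR).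
  exact: mulrl_continuous.
exact: continuous_expR.
Qed.

Let ln_divK (c x : R) : 0 < c -> 0 < x -> expR (c * (ln x / c)) = x.
Proof. by move=> c0 x0; rewrite mulrC divfK ?gt_eqF// lnK. Qed.

Lemma ge0_integral_expR (c : R) (G : R -> R) : 0 < c ->
  {in `]0, +oo[%classic, continuous G} -> (forall x, 0 < x -> 0 <= G x) ->
  (\int[mu]_(x in `]0%R, +oo[) (G x)%:E =
   \int[mu]_x (G (expR (c * x)) * (expR (c * x) * c))%:E)%E.
Proof.
move=> c0 cG G0.
have := @ge0_integral_substitution (fun x => expR (c * x)) G
  (fun n => - n%:R) (fun n => n%:R) setT `]0, +oo[%classic.
rewrite derive1_expRM; apply => //.
- by move=> n; rewrite -subr_ge0 opprK addr_ge0.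
- by move=> m n mn; rewrite lerN2 ler_nat.
- by move=> m n mn; rewrite ler_nat.
- by move=> x y xy; rewrite ltr_expR ltr_pM2l.
- by rewrite bigcup_symitv.
- apply/seteqP; split => [x /=|x [n _] /=]; rewrite !in_itv/=.
    rewrite andbT => x0.
    have : [set: R] (ln x / c) by [].
    rewrite -bigcup_symitv => -[n _] /=; rewrite in_itv/= => /andP[h1 h2].
    exists n => //=; rewrite in_itv/= -(ln_divK c0 x0).
    by rewrite !ler_expR !ler_pM2l// h1 h2.
  by rewrite andbT => /andP[+ _]; apply: lt_le_trans; exact: expR_gt0.
- by move=> x /=; rewrite in_itv/= andbT; exact: G0.
Qed.

Lemma ge0_integral_expR01 (c : R) (G : R -> R) : 0 < c ->
  {in `]0, 1]%classic, continuous G} -> (forall x, 0 < x <= 1 -> 0 <= G x) ->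
  (\int[mu]_(x in `]0%R, 1%R]) (G x)%:E =
   \int[mu]_(x in `]-oo, 0%R]) (G (expR (c * x)) * (expR (c * x) * c))%:E)%E.
Proof.
move=> c0 cG G0.
have := @ge0_integral_substitution (fun x => expR (c * x)) G
  (fun n => - n%:R) (fun n => 0) `]-oo, 0]%classic `]0, 1]%classic.
rewrite derive1_expRM; apply => //.
- by move=> m n mn; rewrite lerN2 ler_nat.
- by move=> x y xy; rewrite ltr_expR ltr_pM2l.
- by rewrite bigcup_symitv0.
- apply/seteqP; split => [x /=|x [n _] /=]; rewrite !in_itv/=.
    move=> /andP[x0 x1].
    have : `]-oo, 0]%classic (ln x / c).
      by rewrite /= in_itv/= pmulr_lle0 ?invr_gt0// ln_le0.
    rewrite -bigcup_symitv0 => -[n _] /=; rewrite in_itv/= => /andP[h1 h2].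
    exists n => //=; rewrite in_itv/= -(ln_divK c0 x0).
    by rewrite !ler_expR !ler_pM2l// h1 h2.
  rewrite mulr0 expR0 => /andP[+ ->]; rewrite andbT.
  by apply: lt_le_trans; exact: expR_gt0.
Qed.

(** The pushforward of Lebesgue measure by a translation gives half-open intervals their length, so
    it is Lebesgue measure by uniqueness. *)
Lemma ge0_integral_shift (c : R) (f : R -> \bar R) :
  measurable_fun setT f -> (forall x, 0 <= f x)%E ->
  (\int[mu]_x f (x + c)%R = \int[mu]_x f x)%E.
Proof.
move=> mf f0.
pose g (x : measurableTypeR R) : measurableTypeR R := x + c.
have mg : measurable_fun setT g by exact: measurable_funD.
transitivity (\int[pushforward mu g]_x f x)%E; last first.
  apply: eq_measure_integral => //= A mA _.
  apply/esym/lebesgue_measure_unique => //= _ [[a b]] _ <-.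
  rewrite /pushforward /g.
  rewrite (_ : _ @^-1` _ = `]a - c, b - c]%classic); last first.
    by apply/seteqP; split => x/=; rewrite !in_itv/= ltrBlDr lerBrDr.
  rewrite !lebesgue_measure_itv/= !lte_fin ltrD2r.
  by case: ifP => // _; rewrite -!EFinD; congr EFin; ring.
by rewrite ge0_integral_pushforward.
Qed.

(** Additivity is applied to the nonnegative functions [g] and [f - g]; the subtraction takes place
    afterwards, between finite values. *)
Lemma ge0_integralB (D : set R) (f g : R -> R) (x y : R) : measurable D ->
  measurable_fun D f -> measurable_fun D g ->
  (forall t, D t -> 0 <= g t <= f t) ->
  (\int[mu]_(t in D) (f t)%:E = x%:E)%E ->
  (\int[mu]_(t in D) (g t)%:E = y%:E)%E ->
  (\int[mu]_(t in D) (f t - g t)%:E = (x - y)%:E)%E.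
Proof.
move=> mD mf mg fg fx gy.
have : (\int[mu]_(t in D) (f t)%:E = \int[mu]_(t in D) (g t)%:E +
    \int[mu]_(t in D) (f t - g t)%:E)%E.
  rewrite -ge0_integralD//; last 4 first.
  - by move=> t /fg /andP[g0 _]; rewrite lee_fin.
  - exact/measurable_EFinP.
  - by move=> t /fg /andP[_ gf]; rewrite lee_fin subr_ge0.
  - by apply/measurable_EFinP; exact: measurable_funB.
  by apply: eq_integral => t _; rewrite -EFinD addrC subrK.
by rewrite fx gy EFinB => ->; rewrite [X in (X - _)%E]addeC addeK.
Qed.

End change_of_variables.

(** * The gamma function and the beta integral *)

Section gamma_kernel.
Context {R : realType}.
Local Notation mu := (@lebesgue_measure R).

(* [t = expR y] turns Euler's integral into an integral over the whole line of
   a smooth function. *)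
Definition gamma_ker (s y : R) : R := expR (s * y - expR y).

(** Values in [\bar R] allow the functional equation to be proved before finiteness, which is then
    deduced from it. *)
Definition eGamma (s : R) : \bar R := (\int[mu]_y (gamma_ker s y)%:E)%E.

Lemma gamma_ker_ge0 s y : 0 <= gamma_ker s y. Proof. exact: expR_ge0. Qed.

Lemma is_derive_gamma_ker (s y : R) :
  is_derive y 1 (gamma_ker s) (s * gamma_ker s y - gamma_ker (s + 1) y).
Proof.
apply: is_derive_eq; rewrite /gamma_ker /GRing.scale/= mulr1.
rewrite (_ : (s + 1) * y - expR y = (s * y - expR y) + y); last by ring.
by rewrite [expR (_ + y)]expRD; ring.
Qed.

Lemma continuous_gamma_ker s : continuous (gamma_ker s).
Proof.
move=> y; apply: differentiable_continuous; apply/derivable1_diffP.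
by have [] := is_derive_gamma_ker s y.
Qed.

Lemma measurable_gamma_ker s : measurable_fun setT (gamma_ker s).
Proof. by apply: continuous_measurable_fun; exact: continuous_gamma_ker. Qed.

Lemma eGamma_ge0 s : (0 <= eGamma s)%E.
Proof. by apply: integral_ge0 => y _; rewrite lee_fin gamma_ker_ge0. Qed.

Lemma powR_continuous (s x : R) : 0 < x -> {for x, continuous (fun t => t `^ s)}.
Proof.
move=> x0; apply: differentiable_continuous; apply/derivable1_diffP.
by apply: derivable_powR; rewrite in_itv/= x0.
Qed.

Lemma Gamma_eGamma (s : R) : Gamma s = fine (eGamma s).
Proof.
rewrite /Gamma /Rintegral (@ge0_integral_expR _ 1)//.
- congr fine; apply: eq_integral => y _; congr EFin.
  rewrite mul1r mulr1 -expRM /gamma_ker -!expRD; congr expR; ring.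
- move=> x; rewrite inE/= in_itv/= andbT => x0; apply: cvgM.
    exact: powR_continuous.
  apply: (@continuous_comp _ _ _ -%R expR).
    exact: opp_continuous.
  exact: continuous_expR.
- by move=> x x0; rewrite mulr_ge0// ?powR_ge0 ?expR_ge0.
Qed.

(* Otherwise unification unfolds [Gamma] to compare its values. *)
Opaque Gamma.

Lemma cvg_expRN_nat (s : R) : 0 < s -> expR (- (s * n%:R)) @[n --> \oo] --> 0.
Proof.
move=> s0; under eq_fun do rewrite -mulNr mulrC expRM_natl.
by apply: cvg_expr; rewrite ger0_norm ?expR_ge0// expR_lt1 oppr_lt0.
Qed.

Lemma cvg_integral_symitv (f : R -> R) : continuous f -> (forall x, 0 <= f x) ->
  (\int[mu]_(x in `[(- n%:R)%R, n%:R]) (f x)%:E)%E @[n --> \oo]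
    --> (\int[mu]_x (f x)%:E)%E.
Proof.
move=> cf f0; apply: ge0_integral_exhaust => //.
- by move=> m n mn; rewrite lerN2 ler_nat.
- by move=> m n mn; rewrite ler_nat.
- by rewrite bigcup_symitv.
- by apply/measurable_EFinP; exact: continuous_measurable_fun.
- by move=> x _; rewrite lee_fin.
Qed.

Lemma FTC2_smooth (f F : R -> R) (a b : R) : a < b -> continuous f ->
  (forall x : R, is_derive x 1 F (f x)) ->
  (\int[mu]_(x in `[a, b]) (f x)%:E = (F b - F a)%:E)%E.
Proof.
move=> ab cf dF; rewrite EFinB.
have cF : continuous F.
  move=> x; apply: differentiable_continuous; apply/derivable1_diffP.
  by have [] := dF x.
apply: continuous_FTC2 => //.
- exact: continuous_subspaceT.
- split.
  + by move=> x _; have [] := dF x.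
  + by apply: cvg_at_right_filter; exact: cF.
  + by apply: cvg_at_left_filter; exact: cF.
- by move=> x _; rewrite derive1E; have [_ ->] := dF x.
Qed.

Lemma integrable_itv_continuous (f : R -> R) (a b : R) : continuous f ->
  mu.-integrable `[a, b] (EFin \o f).
Proof.
move=> cf; apply: continuous_compact_integrable; first exact: segment_compact.
exact: continuous_subspaceT.
Qed.

(** These are the boundary terms of the integration by parts behind the functional equation. *)
Lemma cvg_gamma_ker_bounds (s : R) : 0 < s ->
  gamma_ker s n%:R - gamma_ker s (- n%:R) @[n --> \oo] --> 0.
Proof.
move=> s0; rewrite -[X in _ --> X]subr0; apply: cvgB.
  apply: (@squeeze_cvgr _ _ _ _ (cst 0) (fun n => expR (- (1 * n%:R)))).
  - near=> n; rewrite gamma_ker_ge0/= ler_expR mul1r lerBlDl.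
    have n0 : 0 <= n%:R :> R by [].
    (* The bound [1 + x ^+ 2 / 2 <= expR x] dominates [(s + 1) * x] as soon as [x] reaches
       [2 * (s + 1)], leaving a factor [expR (- x)]. *)
    have /(_ n%:R 1%N n0) h := @expR_ge1Dxn R.
    apply: le_trans (_ : 1 + n%:R ^+ 2 / 2 - n%:R <= _); last first.
      by rewrite lerD2r.
    have : 2 * (s + 1) <= n%:R by near: n; exact: nbhs_infty_ger.
    by move: n0; set x := n%:R => x0 hx; nra.
  - exact: cvg_cst.
  - exact: cvg_expRN_nat.
apply: (@squeeze_cvgr _ _ _ _ (cst 0) (fun n => expR (- (s * n%:R)))).
- near=> n; rewrite gamma_ker_ge0/= ler_expR mulrN lerBlDr lerDl.
  exact: expR_ge0.
- exact: cvg_cst.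
- exact: cvg_expRN_nat.
Unshelve. all: by end_near. Qed.

(** The derivative of [gamma_ker s] is integrated over [[-n, n]], where everything is finite. The
    result is kept as a sum, boundary term plus integral, so that the passage to the limit never
    subtracts infinities. *)
Lemma eGammaS (s : R) : 0 < s -> (eGamma (s + 1) = s%:E * eGamma s)%E.
Proof.
move=> s0.
have A := @cvgeZl _ _ _ _ _ s%:E isT
  (cvg_integral_symitv (@continuous_gamma_ker s) (gamma_ker_ge0 s)).
have B := cvg_integral_symitv (@continuous_gamma_ker (s + 1))
  (gamma_ker_ge0 (s + 1)).
have C : (gamma_ker s n%:R - gamma_ker s (- n%:R))%:E @[n --> \oo] --> 0%:E.
  by apply: cvg_EFin; [exact: nearW|exact: cvg_gamma_ker_bounds].
have D : (0%:E +? eGamma (s + 1))%E by rewrite fin_num_adde_defr.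
have {B C D} := cvgeD D C B; rewrite add0e => BC.
suff A' : ((gamma_ker s n%:R - gamma_ker s (- n%:R))%:E +
    \int[mu]_(x in `[(- n%:R)%R, n%:R]) (gamma_ker (s + 1) x)%:E)%E @[n --> \oo]
    --> (s%:E * eGamma s)%E.
  exact: (cvg_unique _ (BC _) A').
apply: cvg_trans A; apply: near_eq_cvg; near=> n.
have n0 : - n%:R < n%:R :> R by rewrite gtrN// ltr0n; near: n; exists 1%N.
have ik t := @integrable_itv_continuous _ (- n%:R) n%:R (@continuous_gamma_ker t).
have cf : continuous (fun y => s * gamma_ker s y - gamma_ker (s + 1) y).
  move=> y; apply: cvgB; last exact: continuous_gamma_ker.
  by apply: cvgM; [exact: cvg_cst|exact: continuous_gamma_ker].
rewrite -(FTC2_smooth n0 cf (is_derive_gamma_ker s)).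
rewrite integralB_EFin//; last exact: (integrableZl _ s (ik s)).
rewrite [X in (X - _ + _)%E](_ : _ =
    s%:E * \int[mu]_(y in `[(- n%:R)%R, n%:R]) (gamma_ker s y)%:E)%E; last first.
  by rewrite -integralZl//; exact: ik.
rewrite subeK//; exact: (integrable_fin_num _ (ik _)).
Unshelve. all: by end_near. Qed.

Lemma eGamma1 : eGamma 1 = 1%E.
Proof.
have A := cvg_integral_symitv (@continuous_gamma_ker 1) (gamma_ker_ge0 1).
suff A' : (\int[mu]_(x in `[(- n%:R)%R, n%:R]) (gamma_ker 1 x)%:E)%E
    @[n --> \oo] --> (1 : R)%:E.
  exact: (cvg_unique _ A A').
have cN : expR (- n%:R) @[n --> \oo] --> (0 : R).
  by have := @cvg_expRN_nat 1 ltr01; under eq_fun do rewrite mul1r.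
have C1 : expR (- expR (- n%:R)) @[n --> \oo] --> (1 : R).
  have := continuous_cvg _ (@continuous_expR R _) (cvgN cN).
  by rewrite oppr0 expR0; exact.
have C2 : expR (- expR n%:R) @[n --> \oo] --> (0 : R).
  apply: (@squeeze_cvgr _ _ _ _ (cst 0) _ _ _ _ _ cN); last exact: cvg_cst.
  apply: nearW => n; rewrite expR_ge0/= ler_expR lerN2.
  by apply: le_trans (expR_ge1Dx _); rewrite lerDr.
have C : (expR (- expR (- n%:R)) - expR (- expR n%:R))%:E @[n --> \oo] --> (1:R)%:E.
  by apply: cvg_EFin; [exact: nearW|rewrite -[X in _ --> X]subr0; exact: cvgB].
apply: cvg_trans C; apply: near_eq_cvg; near=> n.
have n0 : - n%:R < n%:R :> R by rewrite gtrN// ltr0n; near: n; exists 1%N.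
have dF (y : R) : is_derive y 1 (fun y => - expR (- expR y)) (gamma_ker 1 y).
  by apply: is_derive_eq; rewrite /GRing.scale/= /gamma_ker mul1r expRD; ring.
by rewrite (FTC2_smooth n0 (@continuous_gamma_ker 1) dF) opprK addrC.
Unshelve. all: by end_near. Qed.

Lemma eGammaSn n : eGamma n.+1%:R = (n`!%:R)%:E.
Proof.
elim: n => [|n IH]; first by rewrite eGamma1.
by rewrite -[n.+2]addn1 natrD eGammaS// IH factS natrM EFinM.
Qed.

(** The functional equation moves the argument to [s + 1], which lies between [1] and [n.+1] for
    some [n]. The kernel there is at most the sum of the kernels at these two integers, whose
    integrals are factorials. *)
Lemma eGamma_lty (s : R) : 0 < s -> (eGamma s < +oo)%E.
Proof.
move=> s0; suff : (eGamma (s + 1) < +oo)%E.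
  rewrite eGammaS//; have := eGamma_ge0 s.
  by case: (eGamma s) => [r _ _| |//]; rewrite ?ltry// gt0_muley ?lte_fin// ltxx.
pose n := Num.bound s.
have sn : s < n%:R by rewrite archi_boundP// ltW.
apply: (@le_lt_trans _ _ (eGamma 1 + eGamma n.+1%:R)%E); last first.
  by rewrite eGamma1 eGammaSn ltry.
rewrite -ge0_integralD//; last 4 first.
- by move=> y _; rewrite lee_fin gamma_ker_ge0.
- by apply/measurable_EFinP; exact: measurable_gamma_ker.
- by move=> y _; rewrite lee_fin gamma_ker_ge0.
- by apply/measurable_EFinP; exact: measurable_gamma_ker.
apply: ge0_le_integral => //.
- by move=> y _; rewrite lee_fin gamma_ker_ge0.
- by apply/measurable_EFinP; exact: measurable_gamma_ker.
- by apply/measurable_EFinP; apply: measurable_funD; exact: measurable_gamma_ker.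
- move=> y _; rewrite lee_fin /gamma_ker; have [y0|y0] := leP y 0.
    apply: ler_wpDr; first exact: expR_ge0.
    by rewrite ler_expR lerD2r ler_wnM2r// lerDr ltW.
  apply: ler_wpDl; first exact: expR_ge0.
  by rewrite ler_expR lerD2r ler_wpM2r// ?ltW// -natr1 ltrD2r.
Qed.

(** Convexity of the exponential between [0] and [z]. With [w = expR (h * z)], the tangent bound
    gives [w * (1 - h * z) <= 1] and [w * (1 + (1 - h) * z) <= expR z]; weighting them by [1 - h]
    and [h] cancels the terms in [z]. *)
Lemma expR_convex01 (h z : R) : 0 <= h <= 1 -> expR (h * z) <= 1 - h + h * expR z.
Proof.
move=> /andP[h0 h1].
have e0 : 0 < expR (h * z) by exact: expR_gt0.
have -> : expR z = expR (h * z) * expR ((1 - h) * z).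
  by rewrite -expRD; congr expR; ring.
have a1 := expR_ge1Dx ((1 - h) * z).
have : expR (h * z) * (1 - h * z) <= 1.
  by rewrite mulrC -ler_pdivlMr// div1r -expRN expR_ge1Dx.
move: a1 e0; move: (expR (h * z)) (expR ((1 - h) * z)) => w v a1 w0 a2.
have : h * w * (1 + (1 - h) * z) <= h * (w * v).
  by rewrite mulrA ler_wpM2l// mulr_ge0// ltW.
have : (1 - h) * (w * (1 - h * z)) <= 1 - h.
  by rewrite ler_piMr// subr_ge0.
lra.
Qed.

(** On [[0, 1]] the kernel is at least the constant [expR (- expR 1)]. *)
Lemma eGamma_gt0 (s : R) : 0 < s -> (0 < eGamma s)%E.
Proof.
move=> s0; apply: (@lt_le_trans _ _ (\int[mu]_(y in `[0%R,
  1%R]) (expR (- expR 1))%:E)%E).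
  rewrite integral_cst//= lebesgue_measure_itv/= lte_fin ltr01 oppr0 adde0 mule1.
  by rewrite lte_fin expR_gt0.
apply: (@le_trans _ _ (\int[mu]_(y in `[0%R, 1%R]) (gamma_ker s y)%:E)%E).
  apply: ge0_le_integral => //.
  - by apply/measurable_EFinP; apply: measurable_funS (@measurable_gamma_ker s).
  - move=> y /=; rewrite in_itv/= => /andP[y0 y1].
    rewrite lee_fin ler_expR ler_wpDl ?mulr_ge0//; first exact: ltW.
    by rewrite lerN2 ler_expR.
apply: ge0_subset_integral => //.
- by apply/measurable_EFinP; exact: measurable_gamma_ker.
- by move=> y _; rewrite lee_fin gamma_ker_ge0.
Qed.

Lemma eGammaE (s : R) : 0 < s -> eGamma s = (Gamma s)%:E.
Proof.
by move=> s0; rewrite Gamma_eGamma fineK// ge0_fin_numE ?eGamma_lty ?eGamma_ge0.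
Qed.

Lemma Gamma_gt0 (s : R) : 0 < s -> 0 < Gamma s.
Proof. by move=> s0; rewrite -lte_fin -eGammaE// eGamma_gt0. Qed.

Lemma GammaS (s : R) : 0 < s -> Gamma (s + 1) = s * Gamma s.
Proof.
move=> s0; have := eGammaS s0.
by rewrite !eGammaE ?addr_gt0// -EFinM => -[].
Qed.

Lemma Gamma_nat n : Gamma (n.+1%:R : R) = n`!%:R.
Proof. by apply: EFin_inj; rewrite -eGammaE// eGammaSn. Qed.

Lemma Gamma1 : Gamma 1 = 1 :> R.
Proof. exact: (Gamma_nat 0). Qed.

(* Young's inequality [t `^ h <= s `^ h * ((1 - h) + h * t / s)] under the
   integral sign. *)
Lemma Gamma_le_powR (s h : R) : 0 < s -> 0 <= h <= 1 ->
  Gamma (s + h) <= expR (h * ln s) * Gamma s.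
Proof.
move=> s0 /[dup] h01 /andP[h0 h1].
have sh0 : 0 < s + h by rewrite ltr_wpDr.
pose c1 := expR (h * ln s) * (1 - h); pose c2 := expR (h * ln s) * (h / s).
have c10 : 0 <= c1 by rewrite mulr_ge0 ?expR_ge0// subr_ge0.
have c20 : 0 <= c2 by rewrite mulr_ge0 ?expR_ge0// divr_ge0// ltW.
have -> : expR (h * ln s) * Gamma s = c1 * Gamma s + c2 * Gamma (s + 1).
  by rewrite GammaS// /c1 /c2; field; rewrite gt_eqF.
have : (eGamma (s + h)%R <= c1%:E * eGamma s + c2%:E * eGamma (s + 1)%R)%E; last first.
  have s10 : 0 < s + 1 by rewrite addr_gt0.
  by rewrite !eGammaE// -!EFinM -EFinD lee_fin.
rewrite /eGamma -!ge0_integralZl//; last 4 first.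
- by apply/measurable_EFinP; exact: measurable_gamma_ker.
- by move=> y _; rewrite lee_fin gamma_ker_ge0.
- by apply/measurable_EFinP; exact: measurable_gamma_ker.
- by move=> y _; rewrite lee_fin gamma_ker_ge0.
have mz c t : measurable_fun setT (fun y => c * gamma_ker t y).
  by apply: measurable_funM => //; exact: measurable_gamma_ker.
rewrite -ge0_integralD//; last 4 first.
- by move=> y _; rewrite lee_fin mulr_ge0// gamma_ker_ge0.
- by apply/measurable_EFinP; exact: mz.
- by move=> y _; rewrite lee_fin mulr_ge0// gamma_ker_ge0.
- by apply/measurable_EFinP; exact: mz.
apply: ge0_le_integral => //.
- by move=> y _; rewrite lee_fin gamma_ker_ge0.
- by apply/measurable_EFinP; exact: measurable_gamma_ker.
- by apply/measurable_EFinP; apply: measurable_funD; exact: mz.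
- move=> y _; rewrite lee_fin.
  (* With [t = expR y], the ratio [t / s] of Young's inequality is [expR z]. *)
  pose z := y - ln s.
  have -> : gamma_ker (s + h) y = gamma_ker s y * expR (h * ln s) * expR (h * z).
    by rewrite /gamma_ker /z -!expRD; congr expR; ring.
  have -> : gamma_ker (s + 1) y = gamma_ker s y * s * expR z.
    rewrite /z expRB lnK// /gamma_ker.
    rewrite (_ : (s + 1) * y - expR y = (s * y - expR y) + y); last by ring.
    by rewrite [expR (_ + y)]expRD; field; rewrite gt_eqF.
  rewrite (_ : _ + _ = gamma_ker s y * expR (h * ln s) * (1 - h + h * expR z)).
    apply: ler_wpM2l; first by apply: mulr_ge0; exact: expR_ge0.
    exact: expR_convex01.
  by rewrite /c1 /c2; field; rewrite gt_eqF.
Qed.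
End gamma_kernel.

(** * Euler's beta integral on the real line *)

Section beta.
Context {R : realType}.
Local Notation mu := (@lebesgue_measure R).

Definition softplus (t : R) : R := ln (1 + expR t).

Lemma onePexpR_gt0 (t : R) : 0 < 1 + expR t.
Proof. by rewrite addr_gt0// expR_gt0. Qed.

Lemma expR_softplus t : expR (softplus t) = 1 + expR t.
Proof. by rewrite /softplus lnK// posrE onePexpR_gt0. Qed.

Lemma softplus_gt0 t : 0 < softplus t.
Proof. by rewrite ln_gt0// ltrDl expR_gt0. Qed.

Lemma continuous_softplus : continuous softplus.
Proof.
move=> t; apply: (@continuous_comp _ _ _ (fun t => 1 + expR t) (@ln R)).
  by apply: cvgD; [exact: cvg_cst|exact: continuous_expR].
by apply: continuous_ln; exact: onePexpR_gt0.
Qed.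

(** This is the beta integrand [u ^ a / (1 + u) ^ c] at [u = expR t], written as one exponential so
    that products of kernels become sums of exponents. *)
Definition beta_ker (a c t : R) : R := expR (a * t - c * softplus t).

Lemma continuous_beta_ker a c : continuous (beta_ker a c).
Proof.
move=> t; apply: (@continuous_comp _ _ _ (fun t => a * t - c * softplus t) expR).
  apply: cvgB; apply: cvgM; [exact: cvg_cst|exact: cvg_id|exact: cvg_cst|].
  exact: continuous_softplus.
exact: continuous_expR.
Qed.

Lemma measurable_beta_ker a c : measurable_fun setT (beta_ker a c).
Proof. by apply: continuous_measurable_fun; exact: continuous_beta_ker. Qed.

(* Tonelli's theorem, with the translations [x = t + y] before it and
   [y := y - softplus t] after it. *)
Lemma eGamma_beta (a b : R) : 0 < a -> 0 < b ->
  (eGamma a * eGamma b =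
   eGamma (a + b)%R * \int[mu]_t (beta_ker a (a + b) t)%:E)%E.
Proof.
move=> a0 b0.
have mE d (T : measurableType d) (f : T -> R) :
    measurable_fun setT f -> measurable_fun setT (fun x => (expR (f x))%:E).
  move=> mf; apply/measurable_EFinP; apply: measurableT_comp mf => //.
have mg s : measurable_fun setT (fun y => (@gamma_ker R s y)%:E).
  by apply/measurable_EFinP; exact: measurable_gamma_ker.
have g0 s y : (0 <= (@gamma_ker R s y)%:E)%E by rewrite lee_fin gamma_ker_ge0.
rewrite {2}/eGamma -ge0_integralZl//; last 2 first.
- exact: mg.
- exact: eGamma_ge0.
transitivity (\int[mu]_y \int[mu]_t
    (expR (a * t + (a + b) * y - expR y - expR (t + y)))%:E)%E.
  apply: eq_integral => y _.
  rewrite muleC /eGamma -(ge0_integral_shift y)//.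
  rewrite -ge0_integralZl//; last first.
    by apply: measurableT_comp (mg a) _; exact: measurable_funD.
  apply: eq_integral => t _; rewrite -EFinM; congr EFin.
  by rewrite /gamma_ker -expRD; congr expR; ring.
pose h (p : R * R) := a * p.2 + (a + b) * p.1 - expR p.1 - expR (p.2 + p.1).
have mfst : measurable_fun setT (fst : R * R -> R) by exact: measurable_fst.
have msnd : measurable_fun setT (snd : R * R -> R) by exact: measurable_snd.
have mh : measurable_fun setT h.
  apply: measurable_funB.
    apply: measurable_funB; last by apply: measurableT_comp mfst.
    by apply: measurable_funD; apply: measurable_funM.
  by apply: measurableT_comp => //; exact: measurable_funD.
transitivity (\int[mu]_t \int[mu]_y (expR (h (y, t)))%:E)%E.
  have := @fubini_tonelli _ _ _ _ R mu mu (fun p => (expR (h p))%:E).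
  apply; first exact: mE.
  by move=> p; rewrite lee_fin expR_ge0.
rewrite -ge0_integralZl//; last 3 first.
- by apply/measurable_EFinP; exact: measurable_beta_ker.
- by move=> t _; rewrite lee_fin expR_ge0.
- exact: eGamma_ge0.
apply: eq_integral => t _.
have mht : measurable_fun setT (fun y => (expR (h (y, t)))%:E).
  by apply: mE; apply: measurableT_comp mh _; exact: measurable_fun_pair.
rewrite -(ge0_integral_shift (- softplus t) mht); last first.
  by move=> y; rewrite lee_fin expR_ge0.
rewrite muleC /eGamma -ge0_integralZl//; last 2 first.
- exact: mg.
- by rewrite lee_fin expR_ge0.
apply: eq_integral => y _; rewrite -EFinM; congr EFin.
rewrite /gamma_ker /beta_ker -expRD; congr expR; rewrite /h/=.
(* After the translation the two inner exponentials add up to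
   [expR y * (1 + expR t) / (1 + expR t)], that is [expR y], which decouples [y] from [t]. *)
rewrite (expRD t) !(expRD y) expRN expR_softplus.
by field; rewrite gt_eqF// onePexpR_gt0.
Qed.

(** An infinite integral is excluded because its product with the positive [Gamma (a + b)] equals a
    finite product of gamma values. *)
Lemma beta_integral (a b : R) : 0 < a -> 0 < b ->
  (\int[mu]_t (beta_ker a (a + b) t)%:E =
   (Gamma a * Gamma b / Gamma (a + b))%:E)%E.
Proof.
move=> a0 b0; have := eGamma_beta a0 b0.
have ab0 : 0 < a + b by exact: addr_gt0.
have G0 := Gamma_gt0 ab0.
have : (0 <= \int[mu]_t (beta_ker a (a + b) t)%:E)%E.
  by apply: integral_ge0 => t _; rewrite lee_fin expR_ge0.
rewrite !eGammaE// -EFinM.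
case: (X in (0 <= X)%E) => [r _| |//].
  by rewrite -EFinM => -[->]; rewrite mulrC mulKf// gt_eqF.
by rewrite gt0_muley// lte_fin.
Qed.

End beta.

(** * The digamma and trigamma functions *)

Section digamma_general.
Context {R : realType}.
Implicit Types (x y z s h : R) (n k : nat).

Lemma ln1D_le x : 0 <= x -> ln (1 + x) <= x.
Proof. by move=> x0; apply: le_ln1Dx; rewrite (lt_le_trans _ x0). Qed.

Lemma ln1D_ge x : 0 <= x -> x / (1 + x) <= ln (1 + x).
Proof.
move=> x0; have x1 : 0 < 1 + x by rewrite ltr_wpDr.
have := @le_ln1Dx R (- (x / (1 + x))).
rewrite (_ : 1 + - (x / (1 + x)) = (1 + x)^-1); last by field; rewrite gt_eqF.
rewrite lnV ?posrE// lerN2; apply.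
by rewrite ltrN2 ltr_pdivrMr// mul1r ltrDr.
Qed.

Lemma lnDB_bounds s h : 0 < s -> 0 <= h -> h / (s + h) <= ln (s + h) - ln s <= h / s.
Proof.
move=> s0 h0; have sh0 : 0 < s + h by rewrite ltr_wpDr.
have hs : 0 <= h / s by rewrite divr_ge0// ltW.
rewrite -ln_div ?posrE//.
have -> : (s + h) / s = 1 + h / s by field; rewrite gt_eqF.
rewrite ln1D_le// andbT; have := ln1D_ge hs.
rewrite (_ : h / s / (1 + h / s) = h / (s + h))//; field.
by rewrite !gt_eqF.
Qed.

(* The two properties of [ln Gamma] from which its derivative is computed. *)
Definition log_gamma_like (g : R -> R) :=
  (forall x, 0 < x -> g (x + 1) = g x + ln x) /\
  (forall s h, 0 < s -> 0 <= h <= 1 -> g (s + h) <= g s + h * ln s).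

(** The upper bound is the second property. For the lower one, the same property is used from
    [s + h] with step [1 - h], arriving at [s + 1], where the recurrence gives the exact value. *)
Lemma log_gamma_shift g s h : log_gamma_like g -> 0 < s -> 0 <= h <= 1 ->
  - s^-1 <= g (s + h) - g s - h * ln s <= 0.
Proof.
move=> [gS gle] s0 h01; have /andP[h0 h1] := h01.
have sh0 : 0 < s + h by rewrite ltr_wpDr.
have := gle (s + h) (1 - h) sh0; rewrite subr_ge0 h1 gerBl h0 => /(_ isT).
have -> : s + h + (1 - h) = s + 1 by ring.
rewrite gS// => H1.
have H2 := gle _ _ s0 h01.
have /andP[_ H3] := lnDB_bounds s0 h0.
apply/andP; split; last by lra.
have : (1 - h) * ln (s + h) <= (1 - h) * (ln s + h / s).
  by rewrite ler_wpM2l ?subr_ge0//; lra.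
have : (1 - h) * (h / s) <= s^-1.
  rewrite mulrA -[leRHS]mul1r ler_wpM2r ?invr_ge0//; first exact: ltW.
  by rewrite mulr_ile1// ?subr_ge0// gerBl.
lra.
Qed.

Lemma addr_nat_gt0 x n : 0 < x -> 0 < x + n%:R.
Proof. by move=> x0; rewrite ltr_wpDr. Qed.

Lemma log_gammaDn g x n : log_gamma_like g -> 0 < x ->
  g (x + n%:R) = g x + \sum_(k < n) ln (x + k%:R).
Proof.
move=> [gS _] x0; elim: n => [|n IH]; first by rewrite big_ord0 !addr0.
by rewrite big_ord_recr/= addrA -IH -gS ?addr_nat_gt0// -natr1 addrA.
Qed.

(** Beyond the first term, each inverse square is at most a difference of consecutive inverses, and
    these telescope. *)
Lemma sum_invsq_le x n : 0 < x ->
  \sum_(k < n) (x + k%:R) ^- 2 <= x ^- 2 + x^-1.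
Proof.
move=> x0; have xn0 k := addr_nat_gt0 k x0.
suff H : forall n, \sum_(k < n.+1) (x + k%:R) ^- 2 <= x ^- 2 + x^-1 - (x + n%:R)^-1.
  case: n => [|n].
    by rewrite big_ord0 addr_ge0// invr_ge0 ?exprn_ge0// ltW.
  by apply: le_trans (H n) _; rewrite gerBl invr_ge0 ltW.
elim=> [|{}n IH]; first by rewrite big_ord1 addr0 addrK.
rewrite big_ord_recr/=; apply: le_trans (lerD IH (lexx _)) _.
rewrite -natr1 addrA; set u := x + n%:R.
have u0 : 0 < u by exact: xn0.
have u10 : 0 < u + 1 by rewrite addr_gt0.
have : (u + 1) ^- 2 <= u^-1 - (u + 1)^-1.
  rewrite (_ : u^-1 - (u + 1)^-1 = (u * (u + 1))^-1); last by field; rewrite !gt_eqF.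
  rewrite lef_pV2 ?posrE ?mulr_gt0// ?exprn_gt0//.
  by rewrite expr2 ler_wpM2r ?ltW// ltrDl.
lra.
Qed.

(** Its limit is Euler's expression for the logarithmic derivative of the gamma function. *)
Definition digamma_seq x n : R := ln (x + n%:R) - \sum_(k < n) (x + k%:R)^-1.

Definition psi x : R := limn (digamma_seq x).

(** The sequence decreases, while subtracting the next inverse [(x + n%:R)^-1] makes it increase;
    this second sequence supplies the lower bound. *)
Lemma cvg_digamma_seq x : 0 < x -> digamma_seq x @ \oo --> psi x.
Proof.
move=> x0; have xn0 k := addr_nat_gt0 k x0.
have step n : (x + n.+1%:R)^-1 <= ln (x + n.+1%:R) - ln (x + n%:R) <= (x + n%:R)^-1.
  by have := lnDB_bounds (xn0 n) ler01; rewrite !mul1r -natr1 addrA.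
apply: (nonincreasing_is_cvgn (u_ := digamma_seq x)).
  apply/nonincreasing_seqP => n; rewrite /digamma_seq big_ord_recr/=.
  by have := step n; lra.
exists (ln x - x^-1) => _ [n _ <-].
suff : ln x - x^-1 <= digamma_seq x n - (x + n%:R)^-1.
  by have := xn0 n; rewrite -invr_gt0; lra.
elim: n => [|n IH]; first by rewrite /digamma_seq big_ord0 addr0 subr0.
apply: le_trans IH _; rewrite /digamma_seq big_ord_recr/=.
by have := step n; lra.
Qed.

Lemma cvg_inv_addn x : 0 < x -> (x + n%:R)^-1 @[n --> \oo] --> 0.
Proof.
move=> x0; apply/cvgrPdist_le => e e0; near=> n.
have xn0 : 0 < x + n%:R by exact: addr_nat_gt0.
rewrite sub0r normrN gtr0_norm ?invr_gt0//.
rewrite -[leRHS]invrK lef_pV2 ?posrE ?addr_nat_gt0 ?invr_gt0//.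
have : e^-1 <= n%:R by near: n; exact: nbhs_infty_ger.
lra.
Unshelve. all: by end_near. Qed.

Lemma cvg_norm_le (u v : R^nat) (l c : R) : u @ \oo --> l -> v @ \oo --> 0 ->
  (forall n, `|u n| <= c + v n) -> `|l| <= c.
Proof.
move=> ul v0 uv; rewrite -[c]addr0.
apply: (@ler_cvg_to _ (nbhs \oo) _ R (fun n => `|u n|) (fun n => c + v n)).
- exact: cvg_norm ul.
- by apply: cvgD => //; exact: cvg_cst.
- exact: nearW.
Qed.

(** The increment of [g] is moved to [y + n], where it is [h * ln (y + n%:R)] up to [(y + n%:R)^-1].
    Each logarithmic increment met on the way differs from [h / (y + k%:R)] by at most
    [h ^+ 2 / (y + k%:R) ^+ 2], uniformly summable in [n]. *)
Lemma log_gamma_taylor_right g y h : log_gamma_like g -> 0 < y -> 0 <= h <= 1 ->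
  `|g (y + h) - g y - h * psi y| <= h ^+ 2 * (y ^- 2 + y^-1).
Proof.
move=> gP y0 h01; have /andP[h0 h1] := h01; have yn0 k := addr_nat_gt0 k y0.
have yh0 : 0 < y + h by rewrite ltr_wpDr.
apply: (cvg_norm_le (u := fun n => g (y + h) - g y - h * digamma_seq y n)
   (v := fun n => (y + n%:R)^-1)).
- apply: cvgB; first exact: cvg_cst.
  by apply: cvgM; [exact: cvg_cst|exact: cvg_digamma_seq].
- exact: cvg_inv_addn.
move=> n.
have := log_gamma_shift gP (yn0 n) h01.
rewrite (addrAC y) !(log_gammaDn _ gP)// => E1.
have E2 : 0 <= \sum_(k < n) (h / (y + k%:R)) -
    \sum_(k < n) (ln (y + h + k%:R) - ln (y + k%:R)).
  rewrite -sumrB; apply: sumr_ge0 => k _; rewrite subr_ge0.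
  by have := lnDB_bounds (yn0 k) h0; rewrite addrAC => /andP[].
have E3 : \sum_(k < n) (h / (y + k%:R)) - \sum_(k < n) (ln (y + h + k%:R) -
    ln (y + k%:R))
    <= h ^+ 2 * (y ^- 2 + y^-1).
  apply: le_trans (_ : h ^+ 2 * \sum_(k < n) (y + k%:R) ^- 2 <= _); last first.
    by rewrite ler_wpM2l ?sqr_ge0// sum_invsq_le.
  rewrite -sumrB mulr_sumr; apply: ler_sum => k _.
  have /andP[+ _] := lnDB_bounds (yn0 k) h0; rewrite (addrAC y h).
  set u := y + k%:R => hu.
  have u0 : 0 < u := yn0 k.
  have uh0 : 0 < u + h by rewrite ltr_wpDr.
  suff : h / u - h / (u + h) <= h ^+ 2 * u ^- 2 by lra.
  rewrite (_ : h / u - h / (u + h) = h ^+ 2 * (u * (u + h))^-1); last first.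
    by field; rewrite !gt_eqF.
  rewrite ler_wpM2l ?sqr_ge0// lef_pV2 ?posrE ?mulr_gt0 ?exprn_gt0//.
  by rewrite expr2 ler_wpM2l ?(ltW u0)// lerDl.
rewrite sumrB -mulr_sumr in E2 E3.
have : 0 < (y + n%:R)^-1 by rewrite invr_gt0.
move: E1 => /andP[? ?] ?; rewrite /digamma_seq ler_norml.
apply/andP; split; lra.
Qed.

(** The Hurwitz zeta value at exponent 2, which will be the derivative of [psi]. *)
Definition invsq_series x : R := limn (fun n => \sum_(k < n) (x + k%:R) ^- 2).

Lemma cvg_invsq x : 0 < x ->
  (fun n => \sum_(k < n) (x + k%:R) ^- 2) @ \oo --> invsq_series x.
Proof.
move=> x0; have xn0 k := addr_nat_gt0 k x0.
apply: nondecreasing_is_cvgn.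
  apply/nondecreasing_seqP => n; rewrite big_ord_recr/= lerDl.
  by rewrite invr_ge0 exprn_ge0// ltW.
by exists (x ^- 2 + x^-1) => _ [n _ <-]; exact: sum_invsq_le.
Qed.

(** Termwise, [1/u - 1/v - (v - u)/u^2 = - (v - u)^2 / (u^2 v)] with [u = y + k] and [v = z + k].
    The leftover difference of logarithms tends to 0. *)
Lemma psi_taylor y z : 0 < y -> 0 < z ->
  `|psi z - psi y - (z - y) * invsq_series y| <=
  (z - y) ^+ 2 * ((y ^- 2 + y^-1) / z).
Proof.
move=> y0 z0; have yn0 k := addr_nat_gt0 k y0; have zn0 k := addr_nat_gt0 k z0.
pose T n := \sum_(k < n) (y + k%:R) ^- 2.
have lnb n : `|ln (z + n%:R) - ln (y + n%:R)| <=
    `|z - y| * ((y + n%:R)^-1 + (z + n%:R)^-1).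
  wlog yz : y z y0 z0 yn0 zn0 {T} / y <= z.
    move=> W; have [yz|/ltW zy] := leP y z; first exact: W.
    by rewrite distrC (distrC z) (addrC _^-1); exact: W.
  have zy0 : 0 <= z - y by rewrite subr_ge0.
  have := lnDB_bounds (yn0 n) zy0.
  have -> : y + n%:R + (z - y) = z + n%:R by ring.
  have : 0 <= (z - y) / (z + n%:R) by rewrite divr_ge0// ltW.
  rewrite (ger0_norm zy0) => ? /andP[? ?]; rewrite ger0_norm; lra.
apply: (cvg_norm_le
   (u := fun n => digamma_seq z n - digamma_seq y n - (z - y) * T n)
   (v := fun n => `|z - y| * ((y + n%:R)^-1 + (z + n%:R)^-1))).
- apply: cvgB; first by apply: cvgB; exact: cvg_digamma_seq.
  by apply: cvgM; [exact: cvg_cst|exact: cvg_invsq].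
- rewrite -[X in _ --> X](mulr0 `|z - y|); apply: cvgM; first exact: cvg_cst.
  by rewrite -[X in _ --> X]addr0; apply: cvgD; exact: cvg_inv_addn.
move=> n.
have -> : digamma_seq z n - digamma_seq y n - (z - y) * T n =
    - (z - y) ^+ 2 * (\sum_(k < n) (y + k%:R) ^- 2 / (z + k%:R)) +
    (ln (z + n%:R) - ln (y + n%:R)).
  rewrite /digamma_seq /T.
  suff : \sum_(k < n) (y + k%:R)^-1 - \sum_(k < n) (z + k%:R)^-1
    - (z - y) * \sum_(k < n) (y + k%:R) ^- 2 =
    - (z - y) ^+ 2 * (\sum_(k < n) (y + k%:R) ^- 2 / (z + k%:R)) by lra.
  rewrite !mulr_sumr -!sumrB; apply: eq_bigr => k _; field.
  by rewrite !gt_eqF.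
apply: le_trans (ler_normD _ _) _; apply: lerD; last exact: lnb.
rewrite mulNr normrN normrM ger0_norm ?sqr_ge0// ler_wpM2l ?sqr_ge0//.
rewrite ger0_norm; last first.
  by apply: sumr_ge0 => k _; rewrite divr_ge0 ?invr_ge0 ?exprn_ge0// ltW.
apply: le_trans (_ : (\sum_(k < n) (y + k%:R) ^- 2) / z <= _); last first.
  by rewrite ler_wpM2r ?invr_ge0 ?sum_invsq_le// ltW.
rewrite mulr_suml; apply: ler_sum => k _.
rewrite ler_wpM2l ?invr_ge0 ?exprn_ge0 ?(ltW (yn0 k))//.
by rewrite lef_pV2 ?posrE// lerDl.
Qed.

Lemma is_derive_quadratic (f : R -> R) x (l c d : R) : 0 < d ->
  (forall h, `|h| < d -> `|f (x + h) - f x - h * l| <= c * h ^+ 2) ->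
  is_derive x 1 f l.
Proof.
move=> d0 H.
suff C : h^-1 *: (f (h *: 1 + x) - f x) @[h --> 0^'] --> l.
  apply: DeriveDef; first by apply/cvg_ex; exists l.
  exact/cvg_lim.
apply/cvgrPdist_le => e e0; near=> h.
have h0 : h != 0 by near: h; exact: nbhs_dnbhs_neq.
rewrite distrC /GRing.scale/= mulr1 (addrC h).
have -> : h^-1 * (f (x + h) - f x) - l = h^-1 * (f (x + h) - f x - h * l).
  by field.
rewrite normrM normfV ler_pdivrMl ?normr_gt0//.
apply: le_trans (H h _) _.
  by near: h; apply: dnbhs0_lt.
have h0' : 0 < `|h| by rewrite normr_gt0.
rewrite -(real_normK (num_real h)) expr2 mulrA (mulrC c) mulrAC -mulrA ler_pM2l//.
have c1 : 0 < `|c| + 1 by rewrite ltr_wpDl.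
have : `|h| < e / (`|c| + 1) by near: h; apply: dnbhs0_lt; rewrite divr_gt0.
rewrite ltr_pdivlMr// => he; apply: le_trans (ltW he).
by rewrite ler_wpM2l ?normr_ge0// (le_trans (ler_norm c))// lerDl.
Unshelve. all: by end_near. Qed.

(** The radius [x / 2] keeps [x + h] above [x / 2], so the remainder constant is uniform in [h]. *)
Lemma is_derive_psi x : 0 < x -> is_derive x 1 psi (invsq_series x).
Proof.
move=> x0; pose C := x ^- 2 + x^-1.
have x20 : 0 < x / 2 by rewrite divr_gt0.
apply: (@is_derive_quadratic _ _ _ (C / (x / 2)) (x / 2)) => // h.
rewrite ltr_norml => /andP[h1 h2].
have xh0 : x / 2 < x + h by lra.
have := psi_taylor x0 (lt_trans x20 xh0); rewrite (addrC x h) addrK.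
move=> /le_trans; apply; rewrite mulrC ler_wpM2r ?sqr_ge0//.
rewrite ler_wpM2l//; first by rewrite addr_ge0// invr_ge0 ?exprn_ge0// ltW.
by rewrite lef_pV2 ?posrE// ?(addrC h) ?ltW// (lt_trans x20 xh0).
Qed.

(** The Taylor bound only covers steps to the right. For [h < 0] it is applied from [x + h] with
    step [- h], and [psi_taylor] then replaces [psi (x + h)] by [psi x] at quadratic cost. *)
Lemma is_derive_log_gamma g x : log_gamma_like g -> 0 < x -> is_derive x 1 g (psi x).
Proof.
move=> gP x0; pose C y : R := y ^- 2 + y^-1.
have x20 : 0 < x / 2 by rewrite divr_gt0.
have d0 : 0 < Num.min (x / 2) 1 by rewrite lt_min x20/=.
have C0 y : 0 < y -> 0 < C y.
  by move=> y0; rewrite addr_gt0// invr_gt0// exprn_gt0.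
apply: (@is_derive_quadratic _ _ _ (C (x / 2) + C x + `|invsq_series x|) _ d0) => h.
rewrite lt_min => /andP[hx h1].
have [h0|h0] := leP 0 h.
  have h01 : 0 <= h <= 1 by rewrite h0 -(ger0_norm h0) ltW.
  apply: le_trans (log_gamma_taylor_right gP x0 h01) _.
  rewrite mulrC ler_wpM2r ?sqr_ge0// -/(C x).
  have := C0 _ x20; have := normr_ge0 (invsq_series x); lra.
move: hx; rewrite ltr0_norm// => hx; rewrite ltr0_norm// in h1.
have y0 : x / 2 < x + h by lra.
have y0' := lt_trans x20 y0.
have h01 : 0 <= - h <= 1 by rewrite oppr_ge0 ltW//= ltW.
have := log_gamma_taylor_right gP y0' h01; rewrite addrK sqrrN.
have := psi_taylor x0 y0'; rewrite (addrC x h) addrK (addrC h x).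
rewrite -/(C _) -/(C _) => E1 E2.
have E3 : h ^+ 2 * C (x + h) <= h ^+ 2 * C (x / 2).
  have y1 := ltW y0.
  rewrite ler_wpM2l ?sqr_ge0// lerD// lef_pV2 ?posrE ?exprn_gt0//.
  by rewrite lerXn2r ?nnegrE// ltW.
have E4 : `|h * (psi (x + h) - psi x)| <= h ^+ 2 * (C x + `|invsq_series x|).
  have -> : h * (psi (x + h) - psi x) =
      h * (psi (x + h) - psi x - h * invsq_series x) + h ^+ 2 * invsq_series x.
    by ring.
  apply: le_trans (ler_normD _ _) _; rewrite normrM (normrM (h ^+ 2)) normrX mulrDr.
  rewrite real_normK ?num_real// lerD2r.
  apply: le_trans (ler_wpM2l (normr_ge0 _) E1) _.
  rewrite mulrCA ler_wpM2l ?sqr_ge0// mulrCA ler_piMr//; first exact/ltW/C0.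
  rewrite ler_pdivrMr// mul1r ltr0_norm//; lra.
have -> : g (x + h) - g x - h * psi x =
   - (g x - g (x + h) - - h * psi (x + h)) + h * (psi (x + h) - psi x) by ring.
apply: le_trans (ler_normD _ _) _; rewrite normrN.
by apply: le_trans (lerD (le_trans E2 E3) E4) _; rewrite -mulrDr mulrC addrA.
Qed.

End digamma_general.

(** * Derivatives of the gamma and digamma functions *)

Section digamma.
Context {R : realType}.
Implicit Types (x s h : R).

Definition lnGamma x : R := ln (Gamma x).

Lemma expR_lnGamma x : 0 < x -> expR (lnGamma x) = Gamma x.
Proof. by move=> x0; rewrite /lnGamma lnK// posrE Gamma_gt0. Qed.

Lemma log_gamma_like_lnGamma : log_gamma_like lnGamma.
Proof.
split=> [x x0|s h s0 h01].
  by rewrite /lnGamma GammaS// lnM ?posrE ?Gamma_gt0// addrC.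
have sh0 : 0 < s + h by rewrite ltr_wpDr//; case/andP: h01.
rewrite -ler_expR expR_lnGamma// expRD expR_lnGamma// mulrC.
exact: Gamma_le_powR.
Qed.

Lemma is_derive_Gamma x : 0 < x -> is_derive x 1 Gamma (Gamma x * psi x).
Proof.
move=> x0; apply: (@near_eq_is_derive _ _ _ (expR \o lnGamma)).
  near=> y; apply: expR_lnGamma; near: y; exact: lt_nbhsr.
have dl := is_derive_log_gamma log_gamma_like_lnGamma x0.
have de := is_derive_expR (lnGamma x).
have := @is_derive1_comp _ expR lnGamma x _ _ de dl.
by rewrite expR_lnGamma.
Unshelve. all: by end_near. Qed.

Lemma digammaE x : 0 < x -> digamma x = psi x.
Proof.
move=> x0; rewrite /digamma derive1E; have [_ ->] := is_derive_Gamma x0.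
by rewrite mulrC mulKf// gt_eqF// Gamma_gt0.
Qed.

Lemma trigammaE x : 0 < x -> trigamma x = invsq_series x.
Proof.
move=> x0; rewrite /trigamma derive1E.
suff [_ ->] : is_derive x 1 digamma (invsq_series x) by [].
apply: (near_eq_is_derive _ (is_derive_psi x0)).
by near=> y; apply/esym/digammaE; near: y; exact: lt_nbhsr.
Unshelve. all: by end_near. Qed.

End digamma.

(** * The reflection formula *)

Section cosine_integral.
Context {R : realType}.
Local Notation mu := (@lebesgue_measure R).
Implicit Types (a x : R) (n : nat).

(** Cauchy's cosine integral: for fixed [n] it is proportional to the inverse of
    [Gamma (n + 1 + a) * Gamma (n + 1 - a)]. *)
Definition cosint a n : R :=
  \int[mu]_(x in `[0%R, pi / 2]) (cos (2 * a * x) * cos x ^+ (2 * n)).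

Lemma continuous_cosX a n : continuous (fun x => cos (2 * a * x) * cos x ^+ n).
Proof.
move=> x; apply: cvgM.
  apply: (@continuous_comp _ _ _ (fun x => 2 * a * x) (@cos R)).
    by apply: cvgM; [exact: cvg_cst|exact: cvg_id].
  exact: continuous_cos.
apply: (@continuous_comp _ _ _ (@cos R) (fun x => x ^+ n)).
  exact: continuous_cos.
exact: exprn_continuous.
Qed.

Lemma pihalf_gt0 : 0 < pi / 2 :> R.
Proof. by rewrite divr_gt0// pi_gt0. Qed.

Lemma Rintegral_FTC2 (f F : R -> R) (b : R) : 0 < b -> continuous f ->
  (forall x : R, is_derive x 1 F (f x)) ->
  \int[mu]_(x in `[0%R, b]) f x = F b - F 0.
Proof. by move=> b0 cf dF; rewrite /Rintegral (FTC2_smooth b0 cf dF). Qed.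

Lemma cosint00 : cosint 0 0 = pi / 2.
Proof.
have dF x : is_derive x 1 id (cos (2 * 0 * x) * cos x ^+ (2 * 0)).
  by rewrite mulr0 mul0r cos0 muln0 expr0 mulr1; exact: is_derive_id.
by rewrite /cosint (Rintegral_FTC2 pihalf_gt0 (@continuous_cosX _ _) dF) subr0.
Qed.

Lemma cosint0 a : a != 0 -> cosint a 0 = sin (pi * a) / (2 * a).
Proof.
move=> a0; pose F x := sin (2 * a * x) / (2 * a).
have dF x : is_derive x 1 F (cos (2 * a * x) * cos x ^+ (2 * 0)).
  rewrite muln0 expr0 mulr1; apply: is_derive_eq.
  by rewrite /GRing.scale/=; field.
rewrite /cosint (Rintegral_FTC2 pihalf_gt0 (@continuous_cosX _ _) dF) /F.
by rewrite mulr0 sin0 mul0r subr0; congr (sin _ / _); field.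
Qed.

Lemma integrable_cosX a n (c : R) :
  mu.-integrable `[0%R, c] (EFin \o (fun x => cos (2 * a * x) * cos x ^+ n)).
Proof. by apply: integrable_itv_continuous; exact: continuous_cosX. Qed.

(** Two integrations by parts are packed into one antiderivative [F], which vanishes at [pi / 2]
    through its cosine power and at [0] through its sines. *)
Lemma cosint_rec a n :
  ((2 * n + 2)%:R ^+ 2 - 4 * a ^+ 2) * cosint a n.+1 =
  (2 * n + 2)%:R * (2 * n + 1)%:R * cosint a n.
Proof.
pose N : R := (2 * n + 2)%:R; pose f x := (N ^+ 2 - 4 * a ^+ 2) *
    (cos (2 * a * x) * cos x ^+ (2 * n.+1)) -
  N * (2 * n + 1)%:R * (cos (2 * a * x) * cos x ^+ (2 * n)).
pose F x := cos x ^+ (2 * n).+1 *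
  (- (2 * a) * (cos x * sin (2 * a * x)) + N * (sin x * cos (2 * a * x))).
have cf : continuous f.
  by move=> x; apply: cvgB; apply: cvgM; [exact: cvg_cst|exact: continuous_cosX
    |exact: cvg_cst|exact: continuous_cosX].
have dF x : is_derive x 1 F (f x).
  have d1 : is_derive x 1 (fun x => sin (2 * a * x)) (2 * a * cos (2 * a * x)).
    by apply: is_derive_eq; rewrite /GRing.scale/=; ring.
  have d2 : is_derive x 1 (fun x => cos (2 * a * x)) (- (2 * a * sin (2 * a * x))).
    by apply: is_derive_eq; rewrite /GRing.scale/=; ring.
  have d3 := is_deriveX (2 * n).+1 (is_derive_cos x).
  have d4 := is_deriveM d3 (is_deriveD
    (is_deriveZ (- (2 * a)) (is_deriveM (is_derive_cos x) d1))
    (is_deriveZ N (is_deriveM (is_derive_sin x) d2))).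
  have FE : F = (@cos R) ^+ (2 * n).+1 *
      (- (2 * a) \*: (@cos R * (fun x => sin (2 * a * x))) +
       N \*: (@sin R * (fun x => cos (2 * a * x)))).
    by apply/funext => y; rewrite /F !fctE.
  rewrite FE; apply: (is_derive_eq d4).
  rewrite /GRing.scale/= /f /N !fctE.
  rewrite (_ : (2 * n.+1 = (2 * n).+2)%N); last by rewrite mulnS addnC addn2.
  rewrite (natrD _ (2 * n) 2) (natrD _ (2 * n) 1) -(natr1 (2 * n)).
  rewrite (exprS (cos x) (2 * n).+1) (exprS (cos x) (2 * n)).
  have /= := sin2cos2 x; rewrite expr2.
  move: (cos x ^+ (2 * n)) ((2 * n)%:R) => C K.
  move: (sin (2 * a * x)) (cos (2 * a * x)) => S2 C2.
  rewrite /GRing.scale/=; move: (sin x) (cos x) => s c s2.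
  by ring: s2.
have : \int[mu]_(x in `[0%R, pi / 2]) f x = 0.
  rewrite (Rintegral_FTC2 pihalf_gt0 cf dF) /F cos_pihalf !mul0r.
  by rewrite !exprS !mul0r mulr0 sin0; ring.
rewrite RintegralB//; last 2 first.
- by apply: integrable_itv_continuous => x; apply: cvgM;
  [exact: cvg_cst|exact: continuous_cosX].
- by apply: integrable_itv_continuous => x; apply: cvgM;
  [exact: cvg_cst|exact: continuous_cosX].
rewrite !RintegralZl//; [|exact: integrable_cosX|exact: integrable_cosX].
by move/eqP; rewrite subr_eq0 => /eqP.
Qed.

(* [1 - cos (2 a x) = 2 sin (a x) ^+ 2 <= 2 sin x ^+ 2 = 2 (1 - cos x ^+ 2)]. *)
Lemma cosint_bounds a n : 0 <= a <= 1 ->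
  0 <= cosint 0 n.+1 - cosint a n.+1 <= 2 * (cosint 0 n - cosint 0 n.+1).
Proof.
move=> /andP[a0 a1].
rewrite /cosint -!RintegralB//; [|exact: integrable_cosX..].
have cB b c k l : continuous (fun x => cos (2 * b * x) * cos x ^+ k -
    cos (2 * c * x) * cos x ^+ l).
  by move=> x; apply: cvgB; exact: continuous_cosX.
rewrite -RintegralZl//; last exact: integrable_itv_continuous.
have bnd x : `[0, pi / 2]%classic x ->
    0 <= cos (2 * 0 * x) * cos x ^+ (2 * n.+1) - cos (2 * a * x) * cos x ^+ (2 * n.+1)
      <= 2 * (cos (2 * 0 * x) * cos x ^+ (2 * n) -
        cos (2 * 0 * x) * cos x ^+ (2 * n.+1)).
  rewrite /= in_itv/= => /andP[x0 xpi].
  have c0 : 0 <= cos x by apply: cos_ge0_pihalf; rewrite xpi andbT; lra.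
  rewrite mulr0 mul0r cos0 !mul1r (_ : (2 * n.+1 = (2 * n).+2)%N);
    last by rewrite mulnS.
  rewrite !exprS mulrA -expr2 cos2sin2.
  have -> : cos (2 * a * x) = 1 - sin (a * x) ^+ 2 * 2.
    have -> : 2 * a * x = (a * x) *+ 2 by ring.
    by rewrite cos_mulr2n cos2sin2; ring.
  have ax0 : 0 <= a * x by rewrite mulr_ge0.
  have axx : a * x <= x by rewrite ler_piMl.
  have s1 : 0 <= sin (a * x).
    by rewrite sin_ge0_pi// ax0/=; have := pi_ge0 R; lra.
  have s2 : sin (a * x) <= sin x.
    by rewrite leNgt ltr_sin -?leNgt// in_itv/=; apply/andP; split; lra.
  have s3 : sin (a * x) ^+ 2 <= sin x ^+ 2 by rewrite lerXn2r// ?nnegrE (le_trans s1).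
  have s4 : sin x ^+ 2 <= 1 by rewrite sin2cos2 gerBl sqr_ge0.
  have : 0 <= cos x ^+ (2 * n) by rewrite exprn_ge0.
  move: (sqr_ge0 (sin (a * x))) s3 s4.
  move: (cos x ^+ _) (sin x ^+ 2) (sin (a * x) ^+ 2) => C s t t0 ts s4' C0.
  have h1 : 0 <= t * (1 - s) * C by rewrite !mulr_ge0// subr_ge0.
  have h2 : t * (1 - s) * C <= s * C.
    by rewrite ler_wpM2r// (le_trans _ ts)// ler_piMr// gerBl (le_trans t0 ts).
  by apply/andP; split; lra.
apply/andP; split; first by apply: Rintegral_ge0 => x /bnd /andP[].
apply: le_Rintegral => //.
- exact: integrable_itv_continuous.
- apply: integrable_itv_continuous => x; apply: cvgM; first exact: cvg_cst.
  exact: cB.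
- by move=> x /bnd /andP[].
Qed.

Lemma cosint_gt0 n : 0 < cosint 0 n.
Proof.
elim: n => [|n IH]; first by rewrite cosint00 pihalf_gt0.
have := cosint_rec 0 n; rewrite expr0n/= mulr0 subr0 expr2.
have N0 : 0 < (2 * n + 2)%:R :> R by rewrite ltr0n addn2.
have N1 : 0 < (2 * n + 1)%:R :> R by rewrite ltr0n addn1.
rewrite -!mulrA => /(mulfI (lt0r_neq0 N0)) E.
by rewrite -(pmulr_rgt0 _ N0) E mulr_gt0.
Qed.

End cosine_integral.

Section reflection.
Context {R : realType}.
Implicit Types (a : R) (n : nat).

(** Both steps, from [s - a] to [s] and from [s] to [s + a], have increments close to [a * ln s], so
    the second difference cancels. Every error involved is at most the inverse of [s - a]. *)
Lemma cvg_lnGamma_sym (g : R -> R) a : log_gamma_like g -> 0 < a < 1 ->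
  g (n.+1%:R + a) + g (n.+1%:R - a) - 2 * g n.+1%:R @[n --> \oo] --> 0.
Proof.
move=> gP /andP[a0 a1].
have a'0 : 0 < 1 - a by rewrite subr_gt0.
have C := cvg_inv_addn a'0.
have {}C : 3 * (1 - a + n%:R)^-1 @[n --> \oo] --> 0.
  by rewrite -[X in _ --> X](mulr0 3); apply: cvgM => //; exact: cvg_cst.
apply: norm_cvg0; apply: (squeeze_cvgr _ (cvg_cst 0) C).
apply: nearW => n; rewrite normr_ge0/=.
set s : R := n.+1%:R.
have sE : 1 - a + n%:R = s - a by rewrite /s -natr1; ring.
have t0 : 0 < s - a by rewrite -sE addr_nat_gt0.
have s0 : 0 < s by rewrite ltr0n.
have h01 : 0 <= a <= 1 by rewrite !ltW.
have := log_gamma_shift gP s0 h01; have := log_gamma_shift gP t0 h01.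
have /andP[_] := lnDB_bounds t0 (ltW a0); rewrite subrK sE.
have : s^-1 <= (s - a)^-1 by rewrite lef_pV2 ?posrE// gerBl ltW.
have : 0 <= (s - a)^-1 by rewrite invr_ge0 ltW.
move: (s - a)^-1 => t t1 st l1 /andP[l2 l3] /andP[l4 l5].
have l6 : a * (ln s - ln (s - a)) <= t.
  apply: le_trans (ler_wpM2l (ltW a0) l1) _.
  by rewrite mulrA ler_piMl// mulr_ile1// ltW.
have l7 : 0 <= a * (ln s - ln (s - a)).
  by rewrite mulr_ge0 ?(ltW a0)// subr_ge0 ler_ln ?posrE// gerBl ltW.
have : -3 * t <= g (s + a) + g (s - a) - 2 * g s <= 3 * t.
  clearbody s; move: (s^-1) (g (s + a)) (g s) (g (s - a)) (ln s) (ln (s -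
    a)) st l2 l3 l4 l5 l6 l7.
  by move=> *; apply/andP; split; lra.
by rewrite ler_norml mulNr.
Qed.

Lemma Gamma_ratioE (x y z : R) : 0 < x -> 0 < y -> 0 < z ->
  Gamma x * Gamma y / Gamma z ^+ 2 =
  expR (lnGamma x + lnGamma y - 2 * lnGamma z).
Proof.
move=> x0 y0 z0; rewrite -(expR_lnGamma x0) -(expR_lnGamma y0) -(expR_lnGamma z0).
by move: (lnGamma _) (lnGamma _) (lnGamma _) => A B C;
  rewrite expRB expRD (expRM_natl 2).
Qed.

Lemma Gamma_reflection a : 0 < a < 1 ->
  Gamma a * Gamma (1 - a) = pi / sin (pi * a).
Proof.
move=> a01; have /andP[a0 a1] := a01.
have a'0 : 0 < 1 - a by rewrite subr_gt0.
have s0 n : 0 < n.+1%:R :> R by rewrite ltr0n.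
have sa0 n : 0 < n.+1%:R - a.
  by rewrite -natr1 -addrA; apply: ltr_wpDl.
have sb0 n : 0 < n.+1%:R + a by rewrite addr_gt0.
pose r n := cosint a n / cosint 0 n.
pose w n := Gamma (n.+1%:R + a) * Gamma (n.+1%:R - a) / Gamma (n.+1%:R : R) ^+ 2.
have wE n : w n = expR (lnGamma (n.+1%:R + a) + lnGamma (n.+1%:R - a) -
    2 * lnGamma n.+1%:R).
  exact: Gamma_ratioE.
have cw : w n @[n --> \oo] --> (1 : R).
  have := continuous_cvg (F := \oo) _ (@continuous_expR R 0)
    (cvg_lnGamma_sym log_gamma_like_lnGamma a01).
  rewrite expR0 (funext wE : w = _). exact.
have J0 := @cosint_gt0 R.
have N0 n : (2 * n + 2)%:R = 2 * (n%:R + 1) :> R by rewrite natrD natrM; ring.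
have N1 n : (2 * n + 1)%:R = 2 * n%:R + 1 :> R by rewrite natrD natrM.
have n0 n : 0 < n%:R + 1 :> R by rewrite ltr_wpDl.
have n1 n : 0 < 2 * n%:R + 1 :> R by rewrite ltr_wpDl// mulr_ge0.
have recJ n : cosint 0 n.+1 = (2 * n%:R + 1) / (2 * (n%:R + 1)) * cosint 0 n :> R.
  have := @cosint_rec R 0 n; rewrite N0 N1 expr0n/= mulr0 subr0 => E.
  apply: (@mulfI _ ((2 * (n%:R + 1)) ^+ 2)).
    by rewrite expf_neq0// mulf_neq0 ?gt_eqF// ?n0.
  by rewrite E; field; rewrite gt_eqF ?n0.
have cr : r n @[n --> \oo] --> (1 : R).
  rewrite -cvg_shiftS.
  (* By the recurrence at [a = 0], the bound [2 * (cosint 0 n - cosint 0 n.+1) / cosint 0 n.+1]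
     equals the inverse of [n + 1/2]. *)
  have half0 : 0 < 2^-1 :> R by [].
  have C := cvg_inv_addn half0.
  apply/subr_cvg0; apply: norm_cvg0.
  apply: (squeeze_cvgr _ (cvg_cst 0) C).
  apply: nearW => n; rewrite normr_ge0/=.
  have a01' : 0 <= a <= 1 by rewrite !ltW.
  have := cosint_bounds n a01'; rewrite /r => /andP[b1 b2].
  have -> : cosint a n.+1 / cosint 0 n.+1 - 1 =
      - ((cosint 0 n.+1 - cosint a n.+1) / cosint 0 n.+1).
    by field; rewrite gt_eqF.
  rewrite normrN ger0_norm; last by rewrite divr_ge0// ltW.
  rewrite ler_pdivrMr//; apply: le_trans b2 _.
  rewrite recJ le_eqVlt; apply/orP; left; apply/eqP; field.
  by rewrite !gt_eqF ?n0 ?n1//= mulrC n1.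
have crw : r n * w n @[n --> \oo] --> (1 : R).
  by rewrite -[X in _ --> X]mulr1; exact: cvgM.
have recI n : cosint a n.+1 = (n%:R + 1) * (2 * n%:R + 1) /
    (2 * (n%:R + 1 - a) * (n%:R + 1 + a)) * cosint a n :> R.
  have := @cosint_rec R a n; rewrite N0 N1 => E.
  have d1 : n%:R + 1 - a != 0 by rewrite natr1 gt_eqF.
  have d2 : n%:R + 1 + a != 0 by rewrite natr1 gt_eqF.
  apply: (@mulfI _ ((2 * (n%:R + 1)) ^+ 2 - 4 * a ^+ 2)).
    rewrite (_ : _ - _ = 4 * ((n%:R + 1 - a) * (n%:R + 1 + a))); last by ring.
    by rewrite !mulf_neq0.
  by rewrite E; field; rewrite d1 d2.
(* The factor that [cosint_rec] contributes at each step is the inverse of the one that [GammaS]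
   contributes. *)
have rw0 n : r n * w n = r 0 * w 0.
  elim: n => [|n <-]; first by [].
  rewrite /r /w recI recJ.
  have -> : n.+2%:R + a = n.+1%:R + a + 1 by rewrite -natr1; ring.
  have -> : n.+2%:R - a = n.+1%:R - a + 1 by rewrite -natr1; ring.
  rewrite -[n.+2%:R]natr1 !GammaS//.
  have := Gamma_gt0 (s0 n); have := J0 n; have := sa0 n; have := sb0 n.
  rewrite -[n.+1%:R]natr1.
  move: (Gamma (_ + a)) (Gamma (_ - a)) (Gamma _) (cosint a n) (cosint 0 n).
  move=> G1 G2 G3 I J h1 h2 h3 h4; field.
  by rewrite !gt_eqF//= ?n0 ?n1.
have r0w0 : r 0 * w 0 = 1.
  have : r n * w n @[n --> \oo] --> r 0 * w 0.
    by under eq_fun do rewrite rw0; exact: cvg_cst.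
  by move=> h; exact: (cvg_unique _ h crw).
have sin0 : 0 < sin (pi * a).
  by rewrite sin_gt0_pi// mulr_gt0 ?pi_gt0//= gtr_pMr// pi_gt0.
(* At [n = 0] the product is [sin (pi * a) / (pi * a)] times [Gamma (1 + a) * Gamma (1 - a)], and
   [Gamma (1 + a) = a * Gamma a]. *)
move: r0w0; rewrite /r /w cosint00 cosint0 ?gt_eqF//.
rewrite (Gamma_nat 0) addrC GammaS// fact0.
have := pi_gt0 R; move: (Gamma a) (Gamma (1 - a)) (sin _) sin0 => G1 G2 S S0.
move: (@pi R) => P pi0 E.
have S1 := lt0r_neq0 S0; apply: (mulIf S1).
rewrite divfK// -[RHS]mulr1 -[X in _ = _ * X]E; field.
by rewrite !gt_eqF.
Qed.
End reflection.

(** * Factorization of u^m + 1 *)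

Section factorization.
Context {R : realType}.
Implicit Types (f u th : R) (n m k : nat).

(** For [f = cos th], the real quadratic whose roots are the complex numbers of modulus 1 and
    argument [th] or [- th]. *)
Definition quad f : {poly R} := 'X^2 - (2 * f) *: 'X + 1.

Lemma quadE f u : (quad f).[u] = u ^+ 2 - 2 * f * u + 1.
Proof. by rewrite /quad !hornerE. Qed.

Lemma quad_size_lead f : (size (quad f) = 3) * (lead_coef (quad f) = 1).
Proof.
have sl : (size (1 - (2 * f) *: 'X : {poly R})%R < size ('X^2 : {poly R})%R)%N.
  rewrite size_polyXn; apply: leq_ltn_trans (size_polyD _ _) _.
  by rewrite size_polyN size_poly1 gtn_max/= ltnS (leq_trans (size_scale_leq _
    _))// size_polyX.
have -> : quad f = 'X^2 + (1 - (2 * f) *: 'X) by rewrite /quad; ring.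
by rewrite size_polyDl ?lead_coefDl// size_polyXn lead_coefXn.
Qed.

Lemma monic_quad f : quad f \is monic.
Proof. by rewrite monicE quad_size_lead. Qed.

(** This encodes the remainder of ['X^(n.+1)] modulo the quadratic without complex roots. The
    induction multiplies by ['X] and reduces with the three-term recurrence of the sines. *)
Lemma quad_dvdp_chebyshev th n :
  dvdp (quad (cos th))
    (sin th *: 'X^(n.+1) - sin (n.+1%:R * th) *: 'X + (sin (n%:R * th))%:P).
Proof.
elim: n => [|n IH].
  by rewrite mul1r mul0r sin0 expr1 subrr add0r dvdp0.
have E : sin (n.+2%:R * th) = 2 * cos th * sin (n.+1%:R * th) - sin (n%:R * th).
  have -> : n.+2%:R * th = n.+1%:R * th + th by rewrite -natr1; ring.
  have -> : n%:R * th = n.+1%:R * th - th by rewrite -natr1; ring.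
  by rewrite sinD sinB; ring.
have -> : sin th *: 'X^(n.+2) - sin (n.+2%:R * th) *: 'X + (sin (n.+1%:R * th))%:P =
  'X * (sin th *: 'X^(n.+1) - sin (n.+1%:R * th) *: 'X + (sin (n%:R * th))%:P) +
  sin (n.+1%:R * th) *: quad (cos th).
  rewrite E /quad -!mul_polyC !exprS !rmorphB !rmorphM/=.
  by ring.
by rewrite dvdp_add// ?dvdp_mull// -mul_polyC dvdp_mull.
Qed.

(** The difference of the two quadratics is a nonzero multiple of ['X], and [quad f] is 1 modulo
    ['X]; this yields explicit Bezout coefficients. *)
Lemma quad_coprime f g : f != g -> coprimep (quad f) (quad g).
Proof.
move=> fg; have c0 : - 2 * (f - g) != 0.
  by rewrite mulf_neq0 ?subr_eq0// oppr_eq0.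
apply/Bezout_coprimepP.
pose v := (- 2 * (f - g))^-1 *: ('X - (2 * f)%:P).
exists (1 - v, v) => /=.
suff -> : (1 - v) * quad f + v * quad g = 1 by rewrite eqpxx.
have -> : (1 - v) * quad f + v * quad g = quad f - v * (quad f - quad g) by ring.
have -> : quad f - quad g = (- 2 * (f - g)) *: 'X.
  rewrite /quad -!mul_polyC; ring.
by rewrite /v -scalerAl -scalerAr scalerA mulVf// scale1r /quad -!mul_polyC; ring.
Qed.

Lemma quad_coprime_XD1 f : f != -1 -> coprimep (quad f) ('X + 1).
Proof.
move=> f1; have c0 : 2 * f + 2 != 0.
  by rewrite (_ : _ + _ = 2 * (f - -1)) ?mulf_neq0 ?subr_eq0//; ring.
apply/Bezout_coprimepP.
exists ((2 * f + 2)^-1%:P, - (2 * f + 2)^-1 *: ('X - (2 * f + 1)%:P)) => /=.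
suff -> : (2 * f + 2)^-1%:P * quad f +
    - (2 * f + 2)^-1 *: ('X - (2 * f + 1)%:P) * ('X + 1) = 1 by rewrite eqpxx.
have -> : quad f = ('X - (2 * f + 1)%:P) * ('X + 1) + (2 * f + 2)%:P.
  rewrite /quad -!mul_polyC !rmorphD/=; ring.
by rewrite mulrDr -polyCM mulVf// -!mul_polyC rmorphN/=; ring.
Qed.

Lemma sin_natpi n : sin (n%:R * pi) = 0 :> R.
Proof.
by elim: n => [|n IH]; rewrite ?mul0r ?sin0// -natr1 mulrDl mul1r sinDpi IH oppr0.
Qed.

Lemma cos_oddpi k : cos ((2 * k + 1)%:R * pi) = -1 :> R.
Proof.
elim: k => [|k IH]; first by rewrite mul1r cospi.
have -> : (2 * k.+1 + 1)%:R * pi = (2 * k + 1)%:R * pi + pi *+ 2 :> R.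
  by rewrite mulnS -addnA natrD; ring.
by rewrite cosD2pi.
Qed.

(** For odd [m] the index [m./2] itself would give the angle [pi], hence the real root [-1]; the
    strict bound leaves it to the separate factor ['X + 1]. *)
Lemma varphi_arg_bounds m k : (k < m./2)%N ->
  0 < (2 * k + 1)%:R * (pi : R) / m%:R < pi.
Proof.
move=> km; have km' : (2 * k + 1 < m)%N by lia.
have m0 : 0 < m%:R :> R by rewrite ltr0n; lia.
have k0 : 0 < (2 * k + 1)%:R :> R by rewrite ltr0n addn1.
rewrite divr_gt0 ?(mulr_gt0 k0) ?pi_gt0//=.
by rewrite ltr_pdivrMr// mulrC ltr_pM2l ?pi_gt0// ltr_nat.
Qed.

Lemma varphi_bounds m k : (k < m./2)%N -> -1 < (varphi m k : R) < 1.
Proof.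
move=> /varphi_arg_bounds /andP[h1 h2]; rewrite /varphi.
have b1 : 0 \in `[0, pi : R] by rewrite in_itv/= lexx pi_ge0.
have b2 : pi \in `[0, pi : R] by rewrite in_itv/= lexx pi_ge0.
have b3 : (2 * k + 1)%:R * pi / m%:R \in `[0, pi : R].
  by rewrite in_itv/= (ltW h1) (ltW h2).
by rewrite -[X in X < _]cospi -[X in _ && (_ < X)]cos0 !ltr_cos// h1 h2.
Qed.

Lemma varphi_inj m k l : (k < m./2)%N -> (l < m./2)%N ->
  varphi m k = varphi m l :> R -> k = l.
Proof.
move=> km lm; have /andP[k1 k2] := varphi_arg_bounds km.
have /andP[l1 l2] := varphi_arg_bounds lm.
have m0 : m%:R^-1 != 0 :> R by rewrite invr_eq0 pnatr_eq0; lia.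
move=> /cos_inj; rewrite !in_itv/= !ltW// => /(_ isT isT) /(mulIf m0).
move=> /(mulIf (lt0r_neq0 (pi_gt0 R))) /eqP; rewrite eqr_nat => /eqP; lia.
Qed.

(** Since [m * th] is an odd multiple of [pi], the Chebyshev remainder for exponent [m] turns the
    divided polynomial into [sin th] times ['X^m + 1], and [sin th] is positive. *)
Lemma quad_varphi_dvdp m k : (k < m./2)%N -> dvdp (quad (varphi m k)) ('X^m + 1).
Proof.
move=> km; have := varphi_arg_bounds km; rewrite /varphi.
set th := _ * pi / _ => /sin_gt0_pi s0.
have m0 : (0 < m)%N by lia.
have mth : m%:R * th = (2 * k + 1)%:R * pi.
  by rewrite /th mulrC divfK// pnatr_eq0 -lt0n.
have := quad_dvdp_chebyshev th m.-1; rewrite prednK// mth sin_natpi scale0r subr0.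
have -> : m.-1%:R * th = (2 * k + 1)%:R * pi - th.
  by rewrite -mth -subn1 natrB// mulrBl mul1r.
rewrite sinB sin_natpi cos_oddpi mul0r mulN1r sub0r opprK -[_%:P]alg_polyC -scalerDr.
by rewrite dvdpZr// gt_eqF.
Qed.

Lemma coprimep_prod (p : {poly R}) (F : nat -> {poly R}) n :
  (forall k, (k < n)%N -> coprimep p (F k)) -> coprimep p (\prod_(k < n) F k).
Proof.
elim: n => [|n IH] H; first by rewrite big_ord0 coprimep1.
rewrite big_ord_recr/= coprimepMr IH ?H// => k kn.
by apply: H; rewrite ltnS ltnW.
Qed.

Lemma prod_quad_dvdp m n : (n <= m./2)%N ->
  dvdp (\prod_(k < n) quad (varphi m k)) ('X^m + 1).
Proof.
elim: n => [|n IH] nm; first by rewrite big_ord0 dvd1p.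
rewrite big_ord_recr/= Gauss_dvdp ?IH ?(ltnW nm)//=; first exact: quad_varphi_dvdp.
rewrite coprimep_sym; apply: (@coprimep_prod _ (fun k => quad (varphi m k))) => k kn.
apply: quad_coprime; apply/eqP => /varphi_inj; lia.
Qed.

Lemma size_prod_quad (c : nat -> R) n : size (\prod_(k < n) quad (c k)) = (2 * n).+1.
Proof.
elim: n => [|n IH]; first by rewrite big_ord0 size_poly1.
rewrite big_ord_recr/= size_Mmonic ?monic_quad//; last first.
  by rewrite -size_poly_gt0 IH.
by rewrite IH quad_size_lead; lia.
Qed.

(** The factors are pairwise coprime divisors, so their product divides ['X^m + 1]; both polynomials
    are monic of the same degree. *)
Lemma XnD1_factor m : (0 < m)%N ->
  'X^m + 1 = ('X + 1) ^+ odd m * \prod_(k < m./2) quad (varphi m k) :> {poly R}.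
Proof.
move=> m0; have XC : 'X + 1 = 'X - (-1)%:P :> {poly R} by rewrite polyCN opprK.
have mX : 'X + 1 \is @monic R by rewrite XC monicXsubC.
set P := _ * _; apply/esym/eqP.
have mP : P \is monic.
  by rewrite monicMl ?monic_exp//; apply: monic_prod => k _; exact: monic_quad.
rewrite -eqp_monic//; last by rewrite -(polyC1 R) monicXnaddC.
have dP : dvdp P ('X^m + 1).
  rewrite /P; case modd : (odd m); rewrite ?expr0 ?mul1r ?prod_quad_dvdp// expr1.
  rewrite Gauss_dvdp ?prod_quad_dvdp ?andbT//.
    by rewrite XC dvdp_XsubCl /root !hornerE -signr_odd modd expr1 addNr.
  apply: (@coprimep_prod _ (fun k => quad (varphi m k))) => k km.
  rewrite coprimep_sym quad_coprime_XD1//.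
  by have /andP[h _] := varphi_bounds km; rewrite gt_eqF.
rewrite -dvdp_size_eqp// -(polyC1 R) size_XnaddC//.
rewrite size_Mmonic; last 2 first.
- by rewrite monic_neq0// monic_exp.
- by apply: monic_prod => k _; exact: monic_quad.
rewrite size_prod_quad; have : (odd m + m./2.*2 = m)%N by exact: odd_double_half.
case: (odd m); rewrite ?expr1 ?expr0 ?size_poly1 ?XC ?size_XsubC -muln2 => E;
  apply/eqP; lia.
Qed.

Lemma XnD1_factor_eval m u : (0 < m)%N ->
  u ^+ m + 1 = (u + 1) ^+ odd m * \prod_(k < m./2) (u ^+ 2 - 2 * varphi m k * u + 1).
Proof.
move=> /XnD1_factor /(congr1 (horner^~ u)).
rewrite hornerM horner_exp horner_prod !hornerE => ->; congr (_ * _).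
by apply: eq_bigr => k _; rewrite quadE.
Qed.

End factorization.

(** * Logarithm of the factorization and its power series *)

Section logarithm.
Context {R : realType}.
Implicit Types (t x : R) (n m k : nat).

Definition bump t : R := expR (t - 2 * softplus t).

Lemma bumpE t : bump t = expR t / (1 + expR t) ^+ 2.
Proof. by rewrite /bump expRB (expRM_natl 2) expR_softplus. Qed.

Lemma bump_gt0 t : 0 < bump t. Proof. exact: expR_gt0. Qed.

Lemma bump_le t : bump t <= 4^-1.
Proof.
rewrite bumpE ler_pdivrMr ?exprn_gt0 ?onePexpR_gt0//.
by have := sqr_ge0 (1 - expR t); lra.
Qed.

Definition weight m k : R := 2 * (varphi m k + 1).

Lemma weight_gt0 m k : (k < m./2)%N -> 0 < weight m k.
Proof. by move=> /varphi_bounds-/(_ R) /andP[? _]; rewrite /weight; lra. Qed.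

Lemma weight_bump_lt1 m k t : (k < m./2)%N -> weight m k * bump t < 1.
Proof.
move=> km; have := weight_gt0 km; have := bump_le t; have := bump_gt0 t.
have : weight m k < 4.
  by move: km => /varphi_bounds-/(_ R) /andP[_ ?]; rewrite /weight; lra.
by move: (bump t) (weight m k) => *; nra.
Qed.

(* [u ^+ 2 - 2 f u + 1 = (1 + u) ^+ 2 - 2 (f + 1) u], with [u = expR t]. *)
Lemma softplus_nat m t : (0 < m)%N ->
  softplus (m%:R * t) + \sum_(k < m./2) - ln (1 - weight m k * bump t) =
  m%:R * softplus t.
Proof.
move=> m0; rewrite sumrN; apply/eqP; rewrite subr_eq; apply/eqP.
have p1 := onePexpR_gt0 t.
rewrite {1}/softplus addrC expRM_natl XnD1_factor_eval//.
have qE k : expR t ^+ 2 - 2 * varphi m k * expR t + 1 =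
    (1 + expR t) ^+ 2 * (1 - weight m k * bump t).
  by rewrite bumpE /weight; field; rewrite gt_eqF.
rewrite (eq_bigr _ (fun (k : 'I_m./2) _ => qE k)) big_split/= prodr_const card_ord.
rewrite mulrA -exprM addrC -exprD.
have -> : (odd m + 2 * m./2 = m)%N by rewrite mul2n odd_double_half.
have q0 (k : 'I_m./2) : 0 < 1 - weight m k * bump t.
  by rewrite subr_gt0 weight_bump_lt1.
rewrite lnM ?posrE ?exprn_gt0//; last by apply: prodr_gt0 => k _.
rewrite lnXn// mulr_natl; congr (_ + _).
elim: (m./2) q0 => [|n IH] q0; first by rewrite !big_ord0 ln1.
rewrite !big_ord_recr/= lnM ?posrE ?(q0 ord_max)//.
  by rewrite IH// => k; exact: (q0 (widen_ord (leqnSn n) k)).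
by apply: prodr_gt0 => k _; exact: (q0 (widen_ord (leqnSn n) k)).
Qed.

(** The remainder [f n] vanishes at 0 and has derivative [y ^+ n / (1 - y)], so the mean value
    theorem bounds it by [x ^+ n.+1 / (1 - x)]. *)
Lemma ln1B_series x : 0 <= x < 1 ->
  \sum_(0 <= p < n) x ^+ p.+1 / p.+1%:R @[n --> \oo] --> - ln (1 - x).
Proof.
move=> /andP[]; rewrite le_eqVlt => /predU1P[<- _|x0 x1].
  rewrite subr0 ln1 oppr0 (_ : (fun n => _) = cst 0); first exact: cvg_cst.
  apply/funext => n; rewrite big1// => p _.
  by rewrite expr0n/= mul0r.
pose f n y : R := - ln (1 - y) - \sum_(0 <= p < n) y ^+ p.+1 / p.+1%:R.
have df n (y : R) : y < 1 -> is_derive y 1 (f n) (y ^+ n / (1 - y)).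
  move=> y1; have y10 : 0 < 1 - y by rewrite subr_gt0.
  elim: n => [|n IH].
    have -> : f 0 = fun y => - ln (1 - y).
      by apply/funext => z; rewrite /f big_nil subr0.
    have d1 : is_derive y 1 (fun y : R => 1 - y) (- 1).
      have d0 := is_deriveB (is_derive_cst (1 : R) y 1) (is_derive_id y (1 : R)).
      by apply: (is_derive_eq d0); rewrite sub0r.
    have d2 := is_derive1_ln y10.
    have d3 := @is_derive1_comp R (@ln R) (fun y => 1 - y) y _ _ d2 d1.
    apply: (is_derive_eq (is_deriveN d3)).
    by rewrite mulrN1 opprK expr0 mul1r.
  have -> : f n.+1 = f n - (fun y => n.+1%:R^-1 * y ^+ n.+1).
    by apply/funext => z; rewrite /f big_nat_recr//= opprD addrA !fctE mulrC.
  have d : is_derive y 1 (fun y : R => n.+1%:R^-1 * y ^+ n.+1) (y ^+ n).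
    have d1 := is_deriveZ n.+1%:R^-1 (is_deriveX n.+1 (is_derive_id y 1)).
    rewrite (_ : (fun _ => _) = n.+1%:R^-1 \*: (id : R -> R) ^+ n.+1); last first.
      by apply/funext => z; rewrite !fctE.
    apply: (is_derive_eq d1); rewrite /GRing.scale/= mulr1 mulKf//.
  apply: (is_derive_eq (is_deriveB IH d)).
  by rewrite exprS; field; rewrite gt_eqF.
have B n : 0 <= f n x <= x / (1 - x) * x ^+ n.
  have [y||c] := @MVT R (f n) (fun y => y ^+ n / (1 - y)) 0 x x0.
  - by rewrite in_itv/= => /andP[_ yx]; apply: df; exact: lt_trans yx x1.
  - apply: continuous_in_subspaceT => y; rewrite inE/= in_itv/= => /andP[_ yx].
    apply: differentiable_continuous; apply/derivable1_diffP.
    by have [] := df n y (le_lt_trans yx x1).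
  rewrite in_itv/= => /andP[c0 cx]; have -> : f n 0 = 0.
    rewrite /f subr0 ln1 oppr0 sub0r big1 ?oppr0// => p _.
    by rewrite expr0n/= mul0r.
  rewrite !subr0 => ->; have c1 := lt_trans cx x1.
  rewrite mulr_ge0 ?divr_ge0 ?exprn_ge0 ?subr_ge0 ?(ltW c0) ?(ltW c1) ?(ltW x0)//=.
  rewrite mulrC [leRHS]mulrAC -mulrA ler_pM2l//
    ler_pM ?exprn_ge0 ?invr_ge0 ?subr_ge0 ?(ltW c0) ?(ltW c1)//.
    by rewrite lerXn2r ?nnegrE ?(ltW c0) ?(ltW x0) ?(ltW cx).
  by rewrite lef_pV2 ?posrE ?subr_gt0// lerD2l lerN2 ltW.
have C0 : x / (1 - x) * x ^+ n @[n --> \oo] --> 0.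
  rewrite -[X in _ --> X](mulr0 (x / (1 - x))).
  by apply: cvgM; [exact: cvg_cst|apply: cvg_expr; rewrite ger0_norm// ltW].
have C : f n x @[n --> \oo] --> 0.
  by apply: (squeeze_cvgr _ (cvg_cst 0) C0); exact: nearW.
rewrite -[X in _ --> X]subr0.
rewrite (_ : (fun n => _) = (fun n => - ln (1 - x) - f n x)).
  by apply: cvgB => //; exact: cvg_cst.
by apply/funext => n; rewrite /f opprB addrC subrK.
Qed.
End logarithm.

(** * The logarithmic beta integral *)

Section log_beta.
Context {R : realType}.
Local Notation mu := (@lebesgue_measure R).
Implicit Types (a b h s t : R) (n : nat).

(** The numerator of the difference quotient, at [c = 1], of the beta integral as a function of its
    exponent [c]. *)
Lemma beta_integral_diff a h : 0 < a < 1 -> 0 <= h ->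
  (\int[mu]_t (beta_ker a 1 t - beta_ker a (1 + h) t)%:E =
   (Gamma a * Gamma (1 - a) - Gamma a * Gamma (1 - a + h) / Gamma (1 + h))%:E)%E.
Proof.
move=> /andP[a0 a1] h0.
have b0 : 0 < 1 - a by rewrite subr_gt0.
have bh0 : 0 < 1 - a + h by rewrite ltr_wpDr.
have E1 : (\int[mu]_t (beta_ker a 1 t)%:E = (Gamma a * Gamma (1 - a))%:E)%E.
  rewrite -[in LHS](subrKC a 1) beta_integral// subrKC.
  by rewrite -[in RHS](divr1 (_ * _)); congr (_ / _)%:E; exact: Gamma1.
have E2 : (\int[mu]_t (beta_ker a (1 + h) t)%:E =
    (Gamma a * Gamma (1 - a + h) / Gamma (1 + h))%:E)%E.
  have := beta_integral a0 bh0; have -> // : a + (1 - a + h) = 1 + h by ring.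
apply: ge0_integralB => //; [exact: measurable_beta_ker..|].
move=> t _; rewrite expR_ge0/= ler_expR lerB// ler_pM2r ?softplus_gt0//.
by rewrite lerDl.
Qed.

(** With [x = 2 ^- n * s], the quantity [1 - expR (- x)] lies between [x * (1 - x)] and [x], by the
    tangent bound at [- x] and at [x]. *)
Lemma cvg_exp_quotient s : 0 <= s ->
  (1 - expR (- (2 ^- n * s))) * 2 ^+ n @[n --> \oo] --> s.
Proof.
move=> s0; have C : s * (1 - (2^-1) ^+ n * s) @[n --> \oo] --> s.
  rewrite -[X in _ --> X]mulr1 -[X in s * X]subr0 -[X in _ - X](mul0r s).
  apply: cvgM; first exact: cvg_cst.
  apply: cvgB; first exact: cvg_cst.
  apply: cvgM; last exact: cvg_cst.
  by apply: cvg_expr; rewrite ger0_norm ?invr_ge0// invf_lt1// ltr1n.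
apply: (squeeze_cvgr _ C (cvg_cst s)); apply: nearW => n.
have p0 : 0 < 2 ^+ n :> R by rewrite exprn_gt0.
rewrite exprVn; set x := 2 ^- n * s.
have x0 : 0 <= x by rewrite mulr_ge0// invr_ge0 ltW.
have sE : s = x * 2 ^+ n by rewrite /x mulrAC mulVf ?mul1r// gt_eqF.
have h1 := expR_ge1Dx (- x).
have h2 : expR (- x) * (1 + x) <= 1.
  by rewrite mulrC -ler_pdivlMr ?expR_gt0// div1r -expRN opprK expR_ge1Dx.
apply/andP; split; last first.
  by rewrite [X in _ <= X]sE ler_pM2r//; lra.
rewrite [X in X <= _](_ : _ = x * (1 - x) * 2 ^+ n); last by rewrite {1}sE; ring.
by rewrite ler_pM2r//; move: (expR (- x)) h1 h2 => z h1 h2; nra.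
Qed.

(* Halving the step makes the difference quotients monotone, by
   [1 - z ^+ 2 <= 2 (1 - z)]. *)
Lemma exp_quotient_nondecreasing s n :
  (1 - expR (- (2 ^- n * s))) * 2 ^+ n <=
  (1 - expR (- (2 ^- n.+1 * s))) * 2 ^+ n.+1.
Proof.
have -> : 2 ^- n * s = 2 * (2 ^- n.+1 * s).
  by rewrite exprS; field; rewrite expf_neq0.
rewrite -mulrN (expRM_natl 2) [2 ^+ n.+1]exprS mulrA ler_pM2r ?exprn_gt0//.
by move: (expR _) => z; have := sqr_ge0 (1 - z); lra.
Qed.

Lemma is_derive_shift (f : R -> R) (c l : R) :
  is_derive c 1 f l -> is_derive (0 : R) 1 (fun h => f (c + h)) l.
Proof.
move=> df; have dg := is_deriveD (is_derive_cst c (0 : R) 1) (is_derive_id (0 : R) 1).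
rewrite -[c]addr0 in df.
have := @is_derive1_comp R f (fun h => c + h) 0 _ _ df dg.
by rewrite add0r mulr1.
Qed.

(** Minus the difference quotient of [N / D] at 0 along the steps [2 ^- n]; the limit is given by
    the quotient rule with [D 0 = 1]. *)
Lemma cvg_ratio_quotient (N D : R -> R) (x dN dD : R) :
  is_derive (0 : R) 1 N dN -> is_derive (0 : R) 1 D dD -> N 0 = x -> D 0 = 1 ->
  (x - N (2 ^- n) / D (2 ^- n)) * 2 ^+ n @[n --> \oo] --> x * dD - dN.
Proof.
move=> hN hD <- D0; have D1 : D 0 != 0 by rewrite D0.
have [dv dE] := is_deriveM hN (is_deriveV D1 hD).
have : h^-1 *: ((N * (fun y => (D y)^-1)) (h *: 1 + 0) -
    (N * (fun y => (D y)^-1)) 0) @[h --> 0^'] -->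
    'D_1 (N * (fun y => (D y)^-1)) (0 : R) := dv.
move=> /cvgr_dnbhsP /(_ (fun n => 2 ^- n)) H.
have {}H : (2 ^- n)^-1 *: ((N * (fun y => (D y)^-1)) (2 ^- n *: 1 + 0) -
    (N * (fun y => (D y)^-1)) 0) @[n --> \oo] -->
    'D_1 (N * (fun y => (D y)^-1)) (0 : R).
  apply: H; split=> [n|]; first by rewrite invr_eq0 expf_neq0.
  rewrite (_ : (fun n => _) = (fun n => (2^-1) ^+ n)).
    by apply: cvg_expr; rewrite ger0_norm ?invr_ge0// invf_lt1// ltr1n.
  by apply/funext => n; rewrite exprVn.
have -> : N 0 * dD - dN = - 'D_1 (N * (fun y => (D y)^-1)) (0 : R).
  by rewrite dE /GRing.scale/= D0; field.
suff -> : (fun n => (N 0 - N (2 ^- n) / D (2 ^- n)) * 2 ^+ n) =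
    (fun n => - ((2 ^- n)^-1 *: ((N * (fun y => (D y)^-1)) (2 ^- n *: 1 + 0) -
    (N * (fun y => (D y)^-1)) 0))) by exact: cvgN.
apply/funext => n.
rewrite !fctE /GRing.scale/= invrK mulr1 addr0 D0 invr1 mulr1; ring.
Qed.

Lemma log_beta_quotient a : 0 < a < 1 ->
  (Gamma a * Gamma (1 - a) -
   Gamma a * Gamma (1 - a + 2 ^- n) / Gamma (1 + 2 ^- n)) * 2 ^+ n @[n --> \oo] -->
  Gamma a * Gamma (1 - a) * (psi 1 - psi (1 - a)).
Proof.
move=> /andP[a0 a1]; have b0 : 0 < 1 - a by rewrite subr_gt0.
have dN := is_derive_shift (is_derive_Gamma b0).
have dD := is_derive_shift
  (is_derive_eq (is_derive_Gamma ltr01) (congr1 (fun x => x * psi 1) Gamma1)).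
have H := cvg_ratio_quotient dN dD (congr1 Gamma (addr0 _))
  (etrans (congr1 Gamma (addr0 _)) Gamma1).
have E (x y p1 p2 : R) : x * y * (p1 - p2) = x * (y * (1 * p1) - y * p2) by ring.
rewrite (E (Gamma a)).
suff -> : (fun n => (Gamma a * Gamma (1 - a) -
    Gamma a * Gamma (1 - a + 2 ^- n) / Gamma (1 + 2 ^- n)) * 2 ^+ n) =
  (fun n => Gamma a * ((Gamma (1 - a) -
    Gamma (1 - a + 2 ^- n) / Gamma (1 + 2 ^- n)) * 2 ^+ n)).
  by apply: cvgM; [exact: cvg_cst|exact: H].
by apply/funext => n; rewrite mulrA mulrBr mulrA.
Qed.

(** Differentiation under the integral sign in [c]: the quotients [q n] increase to the integrand,
    and their integrals are known gamma ratios whose limit is [log_beta_quotient]. *)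
Lemma log_beta_integral a : 0 < a < 1 ->
  (\int[mu]_t (beta_ker a 1 t * softplus t)%:E =
   (pi / sin (pi * a) * (psi 1 - psi (1 - a)))%:E)%E.
Proof.
move=> a01; have /andP[a0 a1] := a01.
pose q n t := (beta_ker a 1 t - beta_ker a (1 + 2 ^- n) t) * 2 ^+ n.
have qE n t : q n t = beta_ker a 1 t * ((1 - expR (- (2 ^- n * softplus t))) * 2 ^+ n).
  rewrite /q mulrA; congr (_ * _); rewrite mulrBr mulr1 -expRD.
  by congr (_ - expR _); ring.
have h0 n : 0 <= 2 ^- n :> R by rewrite invr_ge0 exprn_ge0.
have q0 n t : 0 <= q n t.
  rewrite qE !mulr_ge0 ?expR_ge0 ?exprn_ge0// subr_ge0 expR_le1 oppr_le0.
  by rewrite mulr_ge0// ltW// softplus_gt0.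
have mD n : measurable_fun setT (fun t => beta_ker a 1 t - beta_ker a (1 + 2 ^- n) t).
  by apply: measurable_funB; exact: measurable_beta_ker.
have qI n : (\int[mu]_t (q n t)%:E = ((Gamma a * Gamma (1 - a) -
    Gamma a * Gamma (1 - a + 2 ^- n) / Gamma (1 + 2 ^- n)) * 2 ^+ n)%:E)%E.
  rewrite mulrC EFinM -beta_integral_diff// -ge0_integralZl//.
  - by apply: eq_integral => t _; rewrite -EFinM mulrC.
  - by apply/measurable_EFinP; exact: mD.
  - move=> t _; rewrite lee_fin subr_ge0 ler_expR lerB// ler_pM2r ?softplus_gt0//.
    by rewrite lerDl.
have C1 : (\int[mu]_t (q n t)%:E)%E @[n --> \oo] -->
    (\int[mu]_t (beta_ker a 1 t * softplus t)%:E)%E.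
  rewrite [X in _ --> X](_ : _ = \int[mu]_t limn (fun n => (q n t)%:E))%E; last first.
    apply: eq_integral => t _; apply/esym/cvg_lim => //.
    apply: cvg_EFin; first exact: nearW.
    rewrite (_ : _ \o _ = fun n => beta_ker a 1 t *
        ((1 - expR (- (2 ^- n * softplus t))) * 2 ^+ n)).
      by apply: cvgM; [exact: cvg_cst|apply/cvg_exp_quotient/ltW/softplus_gt0].
    by apply/funext => n; exact: qE.
  apply: (@cvg_monotone_convergence _ _ R mu setT measurableT (fun n t => (q n t)%:E)).
  - by move=> n; apply/measurable_EFinP; apply: measurable_funM => //; exact: mD.
  - by move=> n t _; rewrite lee_fin.
  - move=> t _; apply/nondecreasing_seqP => n; rewrite lee_fin !qE.
    by rewrite ler_wpM2l ?expR_ge0// exp_quotient_nondecreasing.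
have C2 := log_beta_quotient a01.
have {C2} : ((Gamma a * Gamma (1 - a) -
    Gamma a * Gamma (1 - a + 2 ^- n) / Gamma (1 + 2 ^- n)) * 2 ^+ n)%:E @[n --> \oo]
    --> (Gamma a * Gamma (1 - a) * (psi 1 - psi (1 - a)))%:E.
  by apply: cvg_EFin => //; exact: nearW.
rewrite -(Gamma_reflection a01) => C2.
rewrite (funext qI) in C1; exact: (cvg_unique _ C1 C2).
Qed.
End log_beta.

(** * The trigamma integral *)

Section exponential_moments.
Context {R : realType}.
Local Notation mu := (@lebesgue_measure R).
Implicit Types (b c t : R) (n j : nat).

Lemma bigcup_nat_itv : \bigcup_n `[0, n%:R]%classic = `[0 : R, +oo[%classic.
Proof.
apply/seteqP; split => [x [n _] /=|x /=]; rewrite !in_itv/= ?andbT.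
  by case/andP.
move=> x0; exists (Num.bound x) => //=.
by rewrite in_itv/= x0/= ltW// archi_boundP.
Qed.

Lemma mulr_expRN_le (x : R) : x * expR (- x) <= 1.
Proof.
rewrite expRN ler_pdivrMr ?expR_gt0// mul1r.
by apply: le_trans (expR_ge1Dx x); rewrite lerDr.
Qed.

Lemma exp_moment c : 0 < c ->
  (\int[mu]_(t in `[0%R, +oo[) (t * expR (- (c * t)))%:E = (c ^- 2)%:E)%E.
Proof.
move=> c0; pose f t := t * expR (- (c * t)).
pose F t := - (t / c + c ^- 2) * expR (- (c * t)).
have dF t : is_derive t 1 F (f t).
  rewrite /F /f; apply: is_derive_eq.
  by rewrite /GRing.scale/=; field; rewrite gt_eqF.
have cf : continuous f.
  move=> t; apply: cvgM; first exact: cvg_id.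
  apply: (@continuous_comp _ _ _ (fun t => - (c * t)) expR);
    last exact: continuous_expR.
  by apply: cvgN; exact: mulrl_continuous.
have A : (\int[mu]_(t in `[0%R, n%:R]) (f t)%:E)%E @[n --> \oo] -->
    (\int[mu]_(t in `[0%R, +oo[) (f t)%:E)%E.
  apply: (@ge0_integral_exhaust _ _ (fun=> 0)) => //.
  - by move=> m n mn; rewrite ler_nat.
  - by rewrite bigcup_nat_itv.
  - apply/measurable_EFinP; apply: measurable_funTS.
    exact: continuous_measurable_fun.
  - by move=> t /=; rewrite in_itv/= andbT => t0; rewrite lee_fin mulr_ge0// expR_ge0.
have F0 : F 0 = - c ^- 2 by rewrite /F mul0r add0r mulr0 oppr0 expR0 mulr1.
have c20 : 0 < c / 2 by rewrite divr_gt0.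
have FN : - F n%:R @[n --> \oo] --> (0 : R).
  (* Half of the exponential decay absorbs the factor [n%:R / c], because [x * expR (- x) <= 1] at
     [x = c / 2 * n%:R]; the other half forces the limit 0. *)
  have C : (2 / c ^+ 2 + c ^- 2) * expR (- (c / 2 * n%:R)) @[n --> \oo] --> (0 : R).
    rewrite -[X in _ --> X](mulr0 (2 / c ^+ 2 + c ^- 2)); apply: cvgM.
      exact: cvg_cst.
    exact: cvg_expRN_nat.
  apply: (squeeze_cvgr _ (cvg_cst 0) C); apply: nearW => n.
  rewrite /F mulNr opprK; set z := expR (- (c / 2 * n%:R)).
  have -> : expR (- (c * n%:R)) = z * z by rewrite /z -expRD; congr expR; field.
  have z0 : 0 < z by exact: expR_gt0.
  have z1 : z <= 1 by rewrite expR_le1 oppr_le0 mulr_ge0// ltW.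
  have cc : 0 < c ^- 2 by rewrite invr_gt0 exprn_gt0.
  rewrite mulrA mulr_ge0 ?mulr_ge0 ?addr_ge0 ?divr_ge0 ?(ltW z0) ?(ltW c0) ?(ltW cc)//=.
  rewrite ler_pM2r// mulrDl lerD//; last by rewrite ler_piMr// ltW.
  have := mulr_expRN_le (c / 2 * n%:R); rewrite -/z => h.
  rewrite (_ : n%:R / c * z = c / 2 * n%:R * z * (2 / c ^+ 2)).
    by rewrite ler_piMl// divr_ge0// exprn_ge0// ltW.
  by field; rewrite gt_eqF.
have B : (\int[mu]_(t in `[0%R, n%:R]) (f t)%:E)%E @[n --> \oo] --> (c ^- 2)%:E.
  have {}FN : (- - F n%:R - F 0)%:E @[n --> \oo] --> (- 0 - F 0)%:E.
    apply: cvg_EFin; first exact: nearW.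
    by apply: cvgB; [exact: cvgN|exact: cvg_cst].
  rewrite F0 oppr0 sub0r opprK in FN.
  apply: cvg_trans FN; apply: near_eq_cvg; near=> n.
  have n0 : 0 < n%:R :> R by rewrite ltr0n; near: n; exists 1%N.
  by rewrite (FTC2_smooth n0 cf dF) F0 !opprK.
exact: (cvg_unique _ A B).
Unshelve. all: by end_near. Qed.

Lemma measurable_texp c (D : set R) :
  measurable_fun D (fun t => t * expR (- (c * t))).
Proof.
apply: measurable_funTS; apply: measurable_funM => //.
by apply: measurableT_comp => //; exact: measurableT_comp.
Qed.

Lemma exp_moment_diff b c : 0 < b -> b <= c ->
  (\int[mu]_(t in `[0%R, +oo[) (t * expR (- (b * t)) - t * expR (- (c * t)))%:E =
   (b ^- 2 - c ^- 2)%:E)%E.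
Proof.
move=> b0 bc; have c0 := lt_le_trans b0 bc.
apply: ge0_integralB => //;
  [exact: measurable_texp|exact: measurable_texp| |exact: exp_moment|exact: exp_moment].
move=> t /=; rewrite in_itv/= andbT => t0.
by rewrite mulr_ge0 ?expR_ge0//= ler_wpM2l// ler_expR lerN2 ler_wpM2r.
Qed.

(* Expand [1 / (1 + expR (- t))] as a geometric series, two terms at a time. *)
Lemma fermi_moment b : 0 < b ->
  (\int[mu]_(t in `[0%R, +oo[) (t * (expR (- (b * t)) / (1 + expR (- t))))%:E =
   (4^-1 * (invsq_series (b / 2) - invsq_series ((b + 1) / 2)))%:E)%E.
Proof.
move=> b0; pose g j t := t * expR (- ((b + 2 * j%:R) * t)) -
  t * expR (- ((b + 2 * j%:R + 1) * t)).
pose T t := t * (expR (- (b * t)) / (1 + expR (- t))).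
have bj0 j : 0 < b + 2 * j%:R by rewrite ltr_wpDr// mulr_ge0.
have g0 j t : 0 <= t -> 0 <= g j t.
  move=> t0; rewrite subr_ge0 ler_wpM2l// ler_expR lerN2 ler_wpM2r// lerDl//.
have mg j D : measurable_fun D (g j).
  by apply: measurable_funB; exact: measurable_texp.
have gI j : (\int[mu]_(t in `[0%R, +oo[) (g j t)%:E =
    ((b + 2 * j%:R) ^- 2 - (b + 2 * j%:R + 1) ^- 2)%:E)%E.
  by apply: exp_moment_diff; rewrite // lerDl.
(* Each pair of terms carries [1 - expR (- t)], and the geometric ratio is [expR (- (2 * t))];
   dividing by [1 - expR (- (2 * t))] leaves the denominator [1 + expR (- t)]. *)
have Sg n t : \sum_(j < n) g j t = T t * (1 - expR (- (2 * t)) ^+ n).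
  have e1 := onePexpR_gt0 (- t).
  elim: n => [|n IH]; first by rewrite big_ord0 expr0 subrr mulr0.
  rewrite big_ord_recr/= IH /g /T exprS.
  rewrite [expR (- ((b + 2 * n%:R) * t))](_ : _ =
    expR (- (b * t)) * expR (- (2 * t)) ^+ n).
    rewrite [expR (- ((b + 2 * n%:R + 1) * t))](_ : _ =
        expR (- (b * t)) * expR (- (2 * t)) ^+ n * expR (- t)).
      rewrite (_ : expR (- (2 * t)) = expR (- t) ^+ 2);
        last by rewrite -mulrN (expRM_natl 2).
      by field; rewrite gt_eqF.
    by rewrite -expRM_natl -!expRD; congr expR; ring.
  by rewrite -expRM_natl -!expRD; congr expR; ring.
have SI n : (\int[mu]_(t in `[0%R, +oo[) (T t * (1 - expR (- (2 * t)) ^+ n))%:E =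
    (4^-1 * (\sum_(j < n) (b / 2 + j%:R) ^- 2 -
      \sum_(j < n) ((b + 1) / 2 + j%:R) ^- 2))%:E)%E.
  transitivity (\int[mu]_(t in `[0%R, +oo[) \sum_(j < n) (g j t)%:E)%E.
    by apply: eq_integral => t _; rewrite -Sg sumEFin.
  rewrite ge0_integral_sum//; last 2 first.
  - by move=> j; apply/measurable_EFinP; exact: mg.
  - by move=> j t /=; rewrite in_itv/= andbT lee_fin; exact: g0.
  under eq_bigr do rewrite gI.
  rewrite sumEFin; congr EFin; rewrite -sumrB mulr_sumr; apply: eq_bigr => j _.
  have b1 := bj0 j; field.

  by rewrite !gt_eqF//; lra.
have A : (\int[mu]_(t in `[0%R, +oo[) (T t * (1 - expR (- (2 * t)) ^+ n))%:E)%E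
    @[n --> \oo] --> (\int[mu]_(t in `[0%R, +oo[) (T t)%:E)%E.
  rewrite [X in _ --> X](_ : _ = \int[mu]_(t in `[0%R, +oo[)
      limn (fun n => (T t * (1 - expR (- (2 * t)) ^+ n))%:E))%E; last first.
    apply: eq_integral => t; rewrite inE/= in_itv/= andbT => t0.
    apply/esym/cvg_lim => //; apply: cvg_EFin; first exact: nearW.
    (* At [t = 0] the ratio is 1 and the geometric argument fails, but [T 0 = 0]. *)
    move: t0; rewrite le_eqVlt => /predU1P[<-|t0].
      rewrite (_ : _ \o _ = cst (T 0)); first exact: cvg_cst.
      by apply/funext => n; rewrite /= /T !mul0r.
    rewrite -[X in _ --> X]mulr1 -[X in T t * X]subr0.
    apply: cvgM; first exact: cvg_cst.
    apply: cvgB; first exact: cvg_cst.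
    by apply: cvg_expr; rewrite ger0_norm ?expR_ge0// expR_lt1 oppr_lt0 mulr_gt0.
  apply: (@cvg_monotone_convergence _ _ R mu _ _
    (fun n t => (T t * (1 - expR (- (2 * t)) ^+ n))%:E)) => //.
  - move=> n; apply/measurable_EFinP.
    rewrite (_ : (fun _ => _) = fun t => \sum_(j < n) g j t).
      by apply: measurable_sum => j; exact: mg.
    by apply/funext => t; rewrite Sg.
  - move=> n t /=; rewrite in_itv/= andbT lee_fin -Sg => t0.
    by apply: sumr_ge0 => j _; exact: g0.
  - move=> t /=; rewrite in_itv/= andbT => t0.
    apply/nondecreasing_seqP => n; rewrite lee_fin -!Sg big_ord_recr/= lerDl.
    exact: g0.
have B : (4^-1 * (\sum_(j < n) (b / 2 + j%:R) ^- 2 -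
    \sum_(j < n) ((b + 1) / 2 + j%:R) ^- 2))%:E @[n --> \oo] -->
    (4^-1 * (invsq_series (b / 2) - invsq_series ((b + 1) / 2)))%:E.
  apply: cvg_EFin; first exact: nearW.
  apply: cvgM; first exact: cvg_cst.
  by apply: cvgB; apply: cvg_invsq; rewrite divr_gt0// addr_gt0.
rewrite (funext SI) in A; exact: (cvg_unique _ A B).
Qed.

End exponential_moments.

(** * Assembling the integral *)

Section main_identity.
Context {R : realType}.
Local Notation mu := (@lebesgue_measure R).
Context (a : R) (m : nat) (a01 : 0 < a < 1) (m0 : (0 < m)%N).
Implicit Types (t : R) (n k p : nat).

Let b0 : 0 < 1 - a. Proof. by rewrite subr_gt0; case/andP: a01. Qed.

Definition log_term k t : R := - ln (1 - weight m k * bump t).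

Lemma log_term_ge0 k t : (k < m./2)%N -> 0 <= log_term k t.
Proof.
move=> km; rewrite oppr_ge0 ln_le0// gerBl mulr_ge0//.
  exact/ltW/weight_gt0.
exact/ltW/bump_gt0.
Qed.

Lemma measurable_softplus : measurable_fun setT (@softplus R).
Proof. by apply: continuous_measurable_fun; exact: continuous_softplus. Qed.

Lemma measurable_softplusZ (c : R) : measurable_fun setT (fun t => softplus (c * t)).
Proof.
by apply: measurableT_comp; [exact: measurable_softplus|exact: measurable_funM].
Qed.

Lemma measurable_bump : measurable_fun setT (@bump R).
Proof.
apply: measurableT_comp => //; apply: measurable_funB => //.
by apply: measurable_funM => //; exact: measurable_softplus.
Qed.

Lemma measurable_log_term k : measurable_fun setT (log_term k).
Proof.
apply: measurableT_comp => //; apply: measurableT_comp => //.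
apply: measurable_funB => //; apply: measurable_funM => //.
exact: measurable_bump.
Qed.

(** The logarithm of the factorization, integrated against [beta_ker a 1]. All terms on the left are
    nonnegative and the right side is real, which later forces each of them to be finite. *)
Lemma log_split :
  (\int[mu]_t (beta_ker a 1 t * softplus (m%:R * t))%:E +
   \sum_(k < m./2) \int[mu]_t (beta_ker a 1 t * log_term k t)%:E =
   (m%:R * (pi / sin (pi * a) * (psi 1 - psi (1 - a))))%:E)%E.
Proof.
have sp0 (t : R) : 0 <= softplus t by exact/ltW/softplus_gt0.
rewrite EFinM -log_beta_integral// -ge0_integralZl//; last 2 first.
- apply/measurable_EFinP; apply: measurable_funM; first exact: measurable_beta_ker.
  exact: measurable_softplus.
- by move=> t _; rewrite lee_fin mulr_ge0// expR_ge0.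
have ml k : measurable_fun setT (fun t => (beta_ker a 1 t * log_term k t)%:E).
  apply/measurable_EFinP; apply: measurable_funM; first exact: measurable_beta_ker.
  exact: measurable_log_term.
have l0 (k : 'I_m./2) t : (0 <= (beta_ker a 1 t * log_term k t)%:E)%E.
  by rewrite lee_fin mulr_ge0// ?expR_ge0// log_term_ge0.
rewrite -ge0_integral_sum//; last by move=> k; exact: ml.
rewrite -ge0_integralD//; last 4 first.
- by move=> t _; rewrite lee_fin mulr_ge0// expR_ge0.
- apply/measurable_EFinP; apply: measurable_funM; first exact: measurable_beta_ker.
  exact: measurable_softplusZ.
- by move=> t _; apply: sume_ge0 => k _; exact: l0.
- by apply: emeasurable_sum => k; exact: ml.
apply: eq_integral => t _; rewrite sumEFin -EFinD -mulr_sumr -mulrDr.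
by rewrite softplus_nat// -EFinM mulrCA.
Qed.

(** The exponent [2 p + 1] is split as [(p + a) + (p + 1 - a)] to fit [beta_integral]. *)
Lemma beta_ker_bump t p :
  beta_ker a 1 t * bump t ^+ p = beta_ker (p%:R + a) (p%:R + a + (p%:R + 1 - a)) t.
Proof.
by rewrite /beta_ker /bump -expRM_natl -expRD; congr expR; ring.
Qed.

Lemma bump_integral p :
  (\int[mu]_t (beta_ker a 1 t * bump t ^+ p)%:E =
   (Gamma (p%:R + a) * Gamma (p%:R + 1 - a) / ((2 * p)`!)%:R)%:E)%E.
Proof.
have /andP[a0 a1] := a01.
under eq_integral do rewrite beta_ker_bump.
rewrite beta_integral; last 2 first.
- by rewrite ltr_wpDl.
- by rewrite -addrA ltr_wpDl.
congr (_ / _)%:E; rewrite -Gamma_nat; congr Gamma.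
by rewrite -natr1 natrM; ring.
Qed.

Definition partial_log n k t : R :=
  \sum_(0 <= p < n) (weight m k * bump t) ^+ p.+1 / p.+1%:R.

Lemma partial_log_integral k n : (k < m./2)%N ->
  (\int[mu]_t (beta_ker a 1 t * partial_log n k t)%:E =
   (inner_partial_sum a^-1 m k n)%:E)%E.
Proof.
move=> km; have c0 : 0 <= weight m k :> R by exact/ltW/weight_gt0.
pose g p t := beta_ker a 1 t * bump t ^+ p.
have mg p : measurable_fun setT (fun t => (g p t)%:E).
  apply/measurable_EFinP; apply: measurable_funM; first exact: measurable_beta_ker.
  by apply: measurable_funX; exact: measurable_bump.
have g0 p t : (0 <= (g p t)%:E)%E.
  by rewrite lee_fin mulr_ge0 ?exprn_ge0 ?expR_ge0.
have d0 p : (0 <= (weight m k ^+ p / p%:R)%:E :> \bar R)%E.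
  by rewrite lee_fin divr_ge0// exprn_ge0.
transitivity (\int[mu]_t \sum_(0 <= p < n)
    ((weight m k ^+ p.+1 / p.+1%:R)%:E * (g p.+1 t)%:E))%E.
  apply: eq_integral => t _; rewrite /partial_log mulr_sumr -sumEFin.
  apply: eq_bigr => p _; rewrite -EFinM; congr EFin.
  by rewrite /g exprMn; ring.
rewrite ge0_integral_sum//; last 2 first.
- by move=> p; apply: emeasurable_funM => //; exact: mg.
- by move=> p t _; rewrite mule_ge0.
rewrite /inner_partial_sum big_add1/= -sumEFin; apply: eq_bigr => p _.
rewrite ge0_integralZl//; last exact: mg.
rewrite [X in (_ * X)%E](bump_integral p.+1) -EFinM; congr EFin.
by rewrite /inner_term invrK /weight exprMn.
Qed.

(** The logarithm series has nonnegative terms, so monotone convergence applies; the limit is taken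
    in [\bar R] because its finiteness is not yet known. *)
Lemma log_term_integral k : (k < m./2)%N ->
  (inner_partial_sum a^-1 m k n)%:E @[n --> \oo] -->
  (\int[mu]_t (beta_ker a 1 t * log_term k t)%:E)%E.
Proof.
move=> km.
have c0 : 0 <= weight m k :> R by exact/ltW/weight_gt0.
have wb0 t : 0 <= weight m k * bump t by rewrite mulr_ge0 ?expR_ge0.
suff A : (\int[mu]_t (beta_ker a 1 t * partial_log n k t)%:E)%E @[n --> \oo] -->
    (\int[mu]_t (beta_ker a 1 t * log_term k t)%:E)%E.
  by rewrite (funext (fun n => partial_log_integral n km)) in A.
rewrite [X in _ --> X](_ : _ =
    \int[mu]_t limn (fun n => (beta_ker a 1 t * partial_log n k t)%:E))%E; last first.
  apply: eq_integral => t _; apply/esym/cvg_lim => //.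
  apply: cvg_EFin; first exact: nearW.
  apply: cvgM; first exact: cvg_cst.
  by apply: ln1B_series; rewrite wb0 weight_bump_lt1.
apply: (@cvg_monotone_convergence _ _ R mu setT measurableT
  (fun n t => (beta_ker a 1 t * partial_log n k t)%:E)).
- move=> n; apply/measurable_EFinP; apply: measurable_funM.
    exact: measurable_beta_ker.
  apply: measurable_sum => p; apply: measurable_funM => //.
  apply: measurable_funX; apply: measurable_funM => //; exact: measurable_bump.
- move=> n t _; rewrite lee_fin mulr_ge0 ?expR_ge0//; apply: sumr_ge0 => p _.
  by rewrite divr_ge0// exprn_ge0.
- move=> t _; apply/nondecreasing_seqP => n; rewrite lee_fin ler_wpM2l ?expR_ge0//.
  by rewrite /partial_log big_nat_recr//= lerDl divr_ge0// exprn_ge0.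
Qed.

End main_identity.

(** * Folding at the origin and the substitution in the original integral *)

Section half_lines.
Context {R : realType}.
Local Notation mu := (@lebesgue_measure R).
Implicit Types (a q t x : R) (m : nat).

Lemma ge0_integral_fold (f : R -> R) : measurable_fun setT f -> (forall t, 0 <= f t) ->
  (\int[mu]_t (f t)%:E =
   \int[mu]_(t in `]-oo, 0%R]) (f t)%:E + \int[mu]_(t in `]-oo, 0%R]) (f (- t))%:E)%E.
Proof.
move=> mf f0; have mfE : measurable_fun setT (EFin \o f) by exact/measurable_EFinP.
rewrite -(@ge0_integration_by_substitution0 _ (fun t => (f t)%:E))//.
rewrite -(@integral_itv_obnd_cbnd _ 0 +oo%O (fun t => (f t)%:E)); last first.
  exact: measurable_funTS.
rewrite -ge0_integral_setU//=.
- congr (integral _ _ _); apply/esym/seteqP; split => // t _ /=.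
  by rewrite !in_itv/= andbT; case: (leP t 0) => ?; [left|right].
- exact: measurable_funTS.
- by move=> t _; rewrite lee_fin.
- apply/disj_setPS => t [] /=; rewrite !in_itv/= andbT => t0.
  by rewrite ltNge t0.
Qed.

Lemma softplusN t : softplus (- t) = softplus t - t.
Proof.
apply: expR_inj; rewrite expRB !expR_softplus expRN; field.
by rewrite gt_eqF// expR_gt0.
Qed.

(** With [a = q^-1], this is the original integrand under [x = expR (a * t)], Jacobian included, up
    to the factor [a]. *)
Definition folded a m t : R :=
  (beta_ker a 1 t + beta_ker (1 - a) 1 t) * softplus (m%:R * t).

(** Reflecting the positive half-line exchanges [a] with [1 - a] and, as
    [softplus (- u) = softplus u - u], produces an extra linear term, integrated by
    [fermi_moment]. *)
Lemma beta_softplus_fold a m : 0 < a < 1 ->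
  (\int[mu]_t (beta_ker a 1 t * softplus (m%:R * t))%:E =
   \int[mu]_(t in `]-oo, 0%R]) (folded a m t)%:E +
   (m%:R * (4^-1 * (invsq_series ((1 - a) / 2) -
      invsq_series ((1 - a + 1) / 2))))%:E)%E.
Proof.
move=> /andP[a0 a1]; have b0 : 0 < 1 - a by rewrite subr_gt0.
have mb c D : measurable_fun D (@beta_ker R c 1).
  by apply: measurable_funTS; exact: measurable_beta_ker.
have ms D : measurable_fun D (fun t => softplus (m%:R * t) : R).
  by apply: measurable_funTS; exact: measurable_softplusZ.
have sp0 (t : R) : 0 <= softplus t by exact/ltW/softplus_gt0.
have k0 c t : 0 <= @beta_ker R c 1 t by exact: expR_ge0.
rewrite ge0_integral_fold; last 2 first.
- by apply: measurable_funM; [exact: mb|exact: ms].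
- by move=> t; rewrite mulr_ge0.
have E t : beta_ker a 1 (- t) * softplus (m%:R * - t) =
    beta_ker (1 - a) 1 t * softplus (m%:R * t) + m%:R * (- t * beta_ker (1 - a) 1 t).
  rewrite mulrN softplusN.
  have -> : beta_ker a 1 (- t) = beta_ker (1 - a) 1 t.
    by rewrite /beta_ker softplusN; congr expR; ring.
  ring.
under [X in (_ + X)%E]eq_integral do rewrite E EFinD.
have mN D : measurable_fun D (fun t => m%:R * (- t * beta_ker (1 - a) 1 t)).
  by apply: measurable_funM => //; apply: measurable_funM => //; exact: mb.
have mp c D : measurable_fun D (fun t => (beta_ker c 1 t * softplus (m%:R * t))%:E).
  by apply/measurable_EFinP; apply: measurable_funM; [exact: mb|exact: ms].
rewrite ge0_integralD//; last 4 first.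
- by move=> t _; rewrite lee_fin mulr_ge0.
- exact: mp.
- move=> t /=; rewrite in_itv/= => t0.
  by rewrite lee_fin !mulr_ge0// oppr_ge0.
- by apply/measurable_EFinP; exact: mN.
rewrite addeA -ge0_integralD//; last 4 first.
- by move=> t _; rewrite lee_fin mulr_ge0.
- exact: mp.
- by move=> t _; rewrite lee_fin mulr_ge0.
- exact: mp.
congr (_ + _)%E.
  by apply: eq_integral => t _; rewrite -EFinD -mulrDl.
(* The absolute value makes the function nonnegative on the whole line, as the reflection rule
   requires. *)
pose h t := `|t| * beta_ker (1 - a) 1 (- t).
have mh : measurable_fun setT h.
  apply: measurable_funM; first exact: normr_measurable.
  by apply: measurableT_comp (mb _ _) _.
have h0 t : (0 <= (h t)%:E)%E by rewrite lee_fin mulr_ge0.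
transitivity (m%:R%:E * \int[mu]_(t in `]-oo, 0%R]) (h (- t))%:E)%E.
  have mhN : measurable_fun (`]-oo, 0]%classic : set R) (fun t => (h (- t))%:E).
    by apply/measurable_EFinP; apply: measurable_funTS; apply: measurableT_comp mh _.
  have m0 : (0 <= (m%:R : R)%:E)%E by rewrite lee_fin.
  rewrite -(ge0_integralZl mu (measurable_itv _) mhN (fun t _ => h0 (- t)) m0).
  apply: eq_integral => t; rewrite inE/= in_itv/= => t0.
  by rewrite -EFinM /h normrN opprK ler0_norm.
rewrite EFinM -fermi_moment//; congr (_ * _)%E.
have mhE : measurable_fun setT (fun t => (h t)%:E) by exact/measurable_EFinP.
rewrite -(ge0_integration_by_substitution0 mhE h0).
apply: eq_integral => t; rewrite inE/= in_itv/= andbT => t0.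
congr (_%:E); rewrite /h ger0_norm// /beta_ker; congr (_ * _).
by rewrite mulrN mul1r expRD expRN expR_softplus.
Qed.

Lemma integrand_ge0 q m x : 0 < x -> 0 <= integrand q m x.
Proof.
move=> x0; rewrite /integrand divr_ge0 ?mulr_ge0 ?addr_ge0 ?powR_ge0//.
by rewrite ln_ge0// lerDr powR_ge0.
Qed.

Lemma continuous_integrand q m x : 0 < x -> {for x, continuous (integrand q m)}.
Proof.
move=> x0.
have cp s : {for x, continuous (fun y => y `^ s + 1)}.
  by apply: cvgD; [exact: powR_continuous|exact: cvg_cst].
have p1 s : 0 < x `^ s + 1 by rewrite ltr_wpDl// powR_ge0.
apply: cvgM; last by apply: cvgV; [rewrite gt_eqF//; exact: p1|exact: cp].
apply: cvgM; first exact: cp.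
apply: (@continuous_comp _ _ _ (fun y => y `^ (m%:R * q) + 1) (@ln R)); first exact: cp.
by apply: continuous_ln; exact: p1.
Qed.

Lemma integrand_substitution q m : 0 < q ->
  (\int[mu]_(x in `[0%R, 1%R]) (integrand q m x)%:E =
   (q^-1)%:E * \int[mu]_(t in `]-oo, 0%R]) (folded q^-1 m t)%:E)%E.
Proof.
move=> q0; have qV0 : 0 < q^-1 by rewrite invr_gt0.
(* The endpoint 0 is dropped, since the logarithmic substitution only reaches positive [x]. *)
rewrite -integral_itv_obnd_cbnd; last first.
  apply/measurable_EFinP; apply: subspace_continuous_measurable_fun => //.
  apply: continuous_in_subspaceT => x; rewrite inE/= in_itv/= => /andP[x0 _].
  exact: continuous_integrand.
rewrite (ge0_integral_expR01 qV0); last 2 first.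
- move=> x; rewrite inE/= in_itv/= => /andP[x0 _]; exact: continuous_integrand.
- by move=> x /andP[x0 _]; exact: integrand_ge0.
rewrite -ge0_integralZl//; last 3 first.
- apply/measurable_EFinP; apply: measurable_funTS; apply: measurable_funM.
    by apply: measurable_funD; exact: measurable_beta_ker.
  exact: measurable_softplusZ.
- move=> t _; rewrite lee_fin mulr_ge0 ?addr_ge0 ?expR_ge0//.
  exact/ltW/softplus_gt0.
- by rewrite lee_fin ltW.
apply: eq_integral => t _; rewrite -EFinM; congr EFin.
rewrite /integrand /folded -!expRM.
have -> : q^-1 * t * (m%:R * q) = m%:R * t by field; rewrite gt_eqF.
have -> : q^-1 * t * q = t by field; rewrite gt_eqF.
(* Together with the Jacobian [expR (q^-1 * t)], this power becomes [expR ((1 - q^-1) * t)], the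
   second kernel of [folded]. *)
have -> : q^-1 * t * (q - 2) = t - 2 * (q^-1 * t) by field; rewrite gt_eqF.
rewrite (addrC (expR (m%:R * t))) -/(softplus _).
rewrite /beta_ker mul1r !(expRD _ (- softplus t)) expRN expR_softplus.
have -> : (1 - q^-1) * t = t - 2 * (q^-1 * t) + q^-1 * t by ring.
rewrite (expRD _ (q^-1 * t)).
have := onePexpR_gt0 t; rewrite (addrC 1 (expR t)) => p1.
by field; rewrite !gt_eqF.
Qed.
End half_lines.

(** Combining [log_split] with the fold gives [F + m M + \sum S k = m L] with nonnegative terms and
    a real right side. Hence each [S k] is finite, the gamma series converge to real limits, and the
    equation can be solved for [F]. *)
Lemma log_integral_closed_form (R : realType) (q : R) (m : nat) :
  1 < q -> (0 < m)%N ->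
  (forall k, (k < m./2)%N -> cvgn (inner_partial_sum q m k)) /\
  (\int[lebesgue_measure]_(x in `[0%R, 1%R]) (integrand q m x)%:E =
   (closed_form q m m./2)%:E)%E.
Proof.
move=> q1 m0; have q0 : 0 < q by exact: lt_trans q1.
have a01 : 0 < q^-1 < 1 by rewrite invr_gt0 q0 invf_lt1.
have b0 : 0 < 1 - q^-1 by rewrite subr_gt0; case/andP: a01.
pose S k := (\int[@lebesgue_measure R]_t
  (beta_ker q^-1 1 t * log_term m k t)%:E)%E.
have S0 k : (k < m./2)%N -> (0 <= S k)%E.
  move=> km; apply: integral_ge0 => t _.
  by rewrite lee_fin mulr_ge0 ?expR_ge0// log_term_ge0.
have F0 : (0 <= \int[@lebesgue_measure R]_(t in `]-oo, 0%R]) (folded q^-1 m t)%:E)%E.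
  apply: integral_ge0 => t _; rewrite lee_fin mulr_ge0 ?addr_ge0 ?expR_ge0//.
  exact/ltW/softplus_gt0.
have := log_split a01 m0; rewrite (beta_softplus_fold m a01).
set M := 4^-1 * _; set L := pi / _ * _; rewrite -/(S _).
rewrite integrand_substitution//; move: F0.
set F := (\int[_]_(t in _) _)%E => F0 E.
have M0 : 0 <= m%:R * M.
  rewrite mulr_ge0// -lee_fin -fermi_moment//; apply: integral_ge0 => t /=.
  rewrite in_itv/= andbT => t0; have := onePexpR_gt0 (- t).
  by rewrite lee_fin mulr_ge0// divr_ge0 ?expR_ge0// ltW.
have SS0 : (0 <= \sum_(k < m./2) S k)%E by apply: sume_ge0 => k _; exact: S0.
have Sfin k : (k < m./2)%N -> S k \is a fin_num.
  move=> km; rewrite ge0_fin_numE ?S0//.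
  apply: (@le_lt_trans _ _ (m%:R * L)%:E); last exact: ltry.
  rewrite -E (bigD1 (Ordinal km))//= addeCA.
  rewrite leeDl// adde_ge0//; last by apply: sume_ge0 => j _; exact: S0.
  by rewrite adde_ge0// lee_fin.
have cS k : (k < m./2)%N -> inner_partial_sum q m k n @[n --> \oo] --> fine (S k).
  move=> km; have := log_term_integral a01 km; rewrite invrK -/(S k).
  by rewrite -[X in _ --> X](fineK (Sfin k km)) => /fine_cvg.
split; first by move=> k km; apply/cvg_ex; exists (fine (S k)); exact: cS.
have SE : (\sum_(k < m./2) S k = (\sum_(0 <= k < m./2) limn (inner_partial_sum
    q m k))%:E)%E.
  rewrite big_mkord -sumEFin; apply: eq_bigr => k _.
  by rewrite (cvg_lim _ (cS _ (ltn_ord k)))// fineK// Sfin.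
have FE : F = (m%:R * L - m%:R * M -
    \sum_(0 <= k < m./2) limn (inner_partial_sum q m k))%:E.
  move: E; rewrite SE; move: F F0 => [r| |]//= _.
  by rewrite -!EFinD => -[<-]; congr EFin; ring.
rewrite FE -EFinM; congr EFin; rewrite /closed_form.
(* The trigamma arguments are [(b + 1) / 2] and [b / 2] of [fermi_moment] at [b = 1 - q^-1]. *)
have -> : (2 * q - 1) / (2 * q) = (1 - q^-1 + 1) / 2 by field; rewrite gt_eqF.
have -> : (q - 1) / (2 * q) = (1 - q^-1) / 2 by field; rewrite gt_eqF.
have sin0 : 0 < sin (pi / q).
  by case/andP: a01 => a0 a1; rewrite sin_gt0_pi// mulr_gt0 ?pi_gt0//= gtr_pMr// pi_gt0.
have h1 : 0 < (1 - q^-1) / 2 by rewrite divr_gt0.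
have h2 : 0 < (1 - q^-1 + 1) / 2 by rewrite divr_gt0// addr_gt0.
rewrite (trigammaE h1) (trigammaE h2) !digammaE// /L /M.
set s := sin (pi / q) in sin0 *; clearbody s.
move: (psi _) (psi _) (invsq_series _) (invsq_series _) (\sum_(_ <= _ < _) _) pi.
by move=> p1 p2 i1 i2 sg P; field; rewrite !gt_eqF.
Qed.

Unset Implicit Arguments.

Theorem theorem2p1 (R : realType) (q : R) (hq : 1 < q) (m : nat) :
  ((2 <= m)%N -> ~~ odd m ->
    (forall k : nat, (k < m %/ 2)%N -> cvgn (inner_partial_sum q m k)) /\
    (\int[lebesgue_measure]_(x in `[0%R, 1%R]) (integrand q m x)%:E
      = (closed_form q m (m %/ 2))%:E)%E) /\
  ((1 <= m)%N -> odd m ->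
    (forall k : nat, (k < (m - 1) %/ 2)%N -> cvgn (inner_partial_sum q m k)) /\
    (\int[lebesgue_measure]_(x in `[0%R, 1%R]) (integrand q m x)%:E
      = (closed_form q m ((m - 1) %/ 2))%:E)%E).
Proof.
split=> m1 modd.
  by rewrite divn2; apply: log_integral_closed_form => //; exact: leq_trans m1.
(* For odd [m] the indices run from 0 to [(m - 3) / 2], which makes [m./2] of them, and none when
   [m = 1]. *)
have -> : ((m - 1) %/ 2 = m./2)%N by lia.
exact: log_integral_closed_form.
Qed.
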